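(* Let $N\in\{4,5,6,7,9,10,12\}$, let $\alpha\in\mathbb{Z}$ be an admissible parameter, and let $E_N$ be the (integral) Tate normal form with parameter $\alpha$, on which $P=(0,0)$ is a torsion point of order $N$ (see context). Let $G_n=\phi_n(P)$, $n\geq 0$, be the sequence of numerators of the $x$-coordinates of the multiples of $P$, and let $n\ge0$ be such that $G_n\ne0$. (''For all $\alpha$'' means for all admissible $\alpha$.) 1. $N=4$. (i) If $n\equiv0\ (4)$, then $G_n=\square$ for all $\alpha$; otherwise $G_n=\square$ iff $\alpha=\square$. (ii) $G_n=C$ for all $\alpha$. 2. $N=5$. (i) If $n\equiv0\ (5)$, then $G_n=\square$ for all $\alpha$; otherwise $G_n=\square$ iff $\alpha=\square$. (ii) If $n\equiv0,2,7,8,13\ (15)$, then $G_n=C$ for all $\alpha$; otherwise $G_n=C$ iff $\alpha=C$. 3. $N=6$. (i) If $n\equiv0\ (6)$, then $G_n=\square$ for all $\alpha$; if $n\equiv3\ (6)$, then $G_n=\square$ iff $\alpha=\square$; otherwise $G_n\ne\square$ for all $\alpha$. (ii) If $n\equiv0,2,6,12,16\ (18)$, then $G_n=C$ for all $\alpha$; if $n\equiv3,9,15\ (18)$, then $G_n=C$ iff $\alpha=C$; otherwise $G_n\neq C$ for all $\alpha$. 4. $N=7$. (i) If $n\equiv0\ (7)$, then $G_n=\square$ for all $\alpha$; if $n\equiv2,5\ (7)$, then $G_n=\square$ iff $\alpha-1=\square$; otherwise $G_n\neq\square$ for all $\alpha$. (ii) If $n\equiv0,2,5,16,19\ (21)$,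 then $G_n=C$ for all $\alpha$; if $n\equiv7,9,12,14\ (21)$, then $G_n=C$ iff $\alpha=C$; otherwise $G_n\ne C$ for all $\alpha$. 5. $N=9$. (i) If $n\equiv0\ (9)$, then $G_n=\square$ for all $\alpha$; if $n\equiv3,6\ (9)$, then $G_n=\square$ iff $\alpha-1=\square$; otherwise $G_n\ne\square$ for all $\alpha$. (ii) If $n\equiv0,2,9,18,25\ (27)$, then $G_n=C$ for all $\alpha$; if $n\equiv5,22\ (27)$, then $G_n=C$ iff $\alpha^2-\alpha+1=C$; otherwise $G_n\ne C$ for all $\alpha$. 6. $N=10$. (i) If $n\equiv0\ (10)$, then $G_n=\square$ for all $\alpha$; if $n\equiv4,6\ (10)$, then $G_n=\square$ iff $(\alpha-1)(2\alpha-1)=\square$; otherwise $G_n\ne\square$ for all $\alpha$. (ii) If $n\equiv0\ (30)$, then $G_n=C$ for all $\alpha$; if $n\equiv2,8,22,28\ (30)$, then $G_n=C$ iff $\alpha^2-3\alpha+1=C$; if $n\equiv12,18\ (30)$, then $G_n=C$ iff $2\alpha-1=C$; otherwise $G_n\neq C$ for all $\alpha$. 7. $N=12$. (i) If $n\equiv0\ (12)$, then $G_n=\square$ for all $\alpha$; otherwise $G_n\ne\square$ for all $\alpha$. (ii) If $n\equiv0,12,24\ (36)$, then $G_n=C$ for all $\alpha$; if $n\equiv16,20\ (36)$, then $G_n=C$ iff $\alpha=C$; if $n\equiv2,34\ (36)$, then $G_n=C$ iff $\alpha-1=C$; otherwise $G_n\neq C$ for all $\alpha$.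
   Context: Notation: ''$m=\square$'' means $m=\pm k^2$ for some non-zero integer $k$ (note the sign $\pm$); ''$m=C$'' means $m=k^3$ for some non-zero integer $k$; $n\equiv r\ (N)$ means congruence modulo $N$. The curves $E_N$. For $N=4,5,6,7,9$, $E_N:\ y^2+(1-c)xy-by=x^3-bx^2$ with: $N=4$: $b=\alpha$, $c=0$; $N=5$: $b=c=\alpha$; $N=6$: $b=\alpha+\alpha^2$, $c=\alpha$; $N=7$: $b=\alpha^3-\alpha^2$, $c=\alpha^2-\alpha$; $N=9$: $c=\alpha^2(\alpha-1)$, $b=c(\alpha(\alpha-1)+1)$. For $N=10,12$ an integral model is used: with $\beta=(2\alpha-1)(\alpha-1)$, $\zeta=-\alpha^2+3\alpha-1$, $\lambda=(3\alpha^2-3\alpha+1)(\alpha-2\alpha^2)$, $\theta=2\alpha-2\alpha^2-1$, $E_{10}:\ y^2+(\zeta^2-\alpha\beta\zeta)xy-\alpha^3\beta\zeta^4y=x^3-\alpha^3\beta\zeta^2x^2$, $E_{12}:\ y^2+(\alpha-1)((\alpha-1)^3-\lambda)xy-(\alpha-1)^8\lambda\theta y=x^3-(\alpha-1)^4\lambda\theta x^2$. Admissible integers $\alpha$: $\alpha\ne0$ for $N=4,5$; $\alpha\neq-1,0$ for $N=6$; $\alpha\ne0,1$ for $N=7,9,10,12$. Division polynomials. For an elliptic curve $y^{2}+a_{1}xy+a_{3}y=x^{3}+a_{2}x^{2}+a_{4}x+a_{6}$ put $b_2=a_1^2+4a_2$, $b_4=2a_4+a_1a_3$, $b_6=a_3^2+4a_6$,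 $b_8=a_1^2a_6+4a_2a_6-a_1a_3a_4+a_2a_3^2-a_4^2$. Define $\psi_0=0$, $\psi_1=1$, $\psi_2=2y+a_1x+a_3$, $\psi_3=3x^4+b_2x^3+3b_4x^2+3b_6x+b_8$, $\psi_4=\psi_2\,(2x^6+b_2x^5+5b_4x^4+10b_6x^3+10b_8x^2+(b_2b_8-b_4b_6)x+(b_4b_8-b_6^2))$, and $\psi_{2n+1}=\psi_{n+2}\psi_n^3-\psi_{n-1}\psi_{n+1}^3$ $(n\ge2)$, $\psi_{2n}\psi_2=\psi_{n-1}^2\psi_n\psi_{n+2}-\psi_{n-2}\psi_n\psi_{n+1}^2$ $(n\ge3)$. Further $\phi_0=1$, $\phi_1=x$, and $\phi_n=x\psi_n^2-\psi_{n+1}\psi_{n-1}$ for $n\ge2$. If $\psi_n(P)\ne0$ then the $x$-coordinate of $[n]P$ is $\phi_n(P)/\psi_n(P)^2$. *)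

(* Defs.v *)
From mathcomp Require Import all_boot all_order all_algebra.
From mathcomp Require Import zify ring.

Set Implicit Arguments.
Unset Strict Implicit.
Unset Printing Implicit Defensive.

Import Order.TTheory GRing.Theory Num.Theory.
Local Open Scope ring_scope.

(* The sign is part of the convention: m = k^2 or m = - k^2, with k <> 0. *)
Definition is_square (m : int) : Prop :=
  exists k : int, k != 0 /\ (m = k ^+ 2 \/ m = - k ^+ 2).

Definition is_cube (m : int) : Prop :=
  exists k : int, k != 0 /\ m = k ^+ 3.

(* y^2 + a1 x y + a3 y = x^3 + a2 x^2 + a4 x + a6 *)
Record weierstrass := Weierstrass
  { w_a1 : int; w_a2 : int; w_a3 : int; w_a4 : int; w_a6 : int }.

Section DivisionPolynomials.
Variable W : weierstrass.
Local Notation a1 := (w_a1 W).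
Local Notation a2 := (w_a2 W).
Local Notation a3 := (w_a3 W).
Local Notation a4 := (w_a4 W).
Local Notation a6 := (w_a6 W).

Definition w_b2 : int := a1 ^+ 2 + 4 * a2.
Definition w_b4 : int := 2 * a4 + a1 * a3.
Definition w_b6 : int := a3 ^+ 2 + 4 * a6.
Definition w_b8 : int :=
  a1 ^+ 2 * a6 + 4 * a2 * a6 - a1 * a3 * a4 + a2 * a3 ^+ 2 - a4 ^+ 2.
Local Notation b2 := w_b2.
Local Notation b4 := w_b4.
Local Notation b6 := w_b6.
Local Notation b8 := w_b8.

(* Z[x, y] is {poly {poly int}}, with inner variable x and outer variable y. *)
Local Notation x := ('X%:P : {poly {poly int}}).
Local Notation y := ('X : {poly {poly int}}).
Local Notation "c %:K" := ((c : int)%:P%:P : {poly {poly int}})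
  (at level 1, format "c %:K").

Definition psi2 : {poly {poly int}} := 2 * y + a1%:K * x + a3%:K.

Definition psi3 : {poly {poly int}} :=
  3 * x ^+ 4 + b2%:K * x ^+ 3 + 3 * b4%:K * x ^+ 2 + 3 * b6%:K * x + b8%:K.

Definition psi4 : {poly {poly int}} :=
  psi2 * (2 * x ^+ 6 + b2%:K * x ^+ 5 + 5 * b4%:K * x ^+ 4
          + 10 * b6%:K * x ^+ 3 + 10 * b8%:K * x ^+ 2
          + (b2 * b8 - b4 * b6)%:K * x + (b4 * b8 - b6 ^+ 2)%:K).

Definition is_division_sequence (psi : nat -> {poly {poly int}}) : Prop :=
  [/\ psi 0%N = 0,
      [/\ psi 1%N = 1, psi 2%N = psi2, psi 3%N = psi3 & psi 4%N = psi4],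
      forall n : nat, (2 <= n)%N ->
        psi (2 * n + 1)%N
          = psi (n + 2)%N * psi n ^+ 3 - psi (n - 1)%N * psi (n + 1)%N ^+ 3
    & forall n : nat, (3 <= n)%N ->
        psi (2 * n)%N * psi2
          = psi (n - 1)%N ^+ 2 * psi n * psi (n + 2)%N
            - psi (n - 2)%N * psi n * psi (n + 1)%N ^+ 2].

End DivisionPolynomials.

(* Existence, before reducing modulo the equation of the curve: psi_n is
   psi2^(n even) times the sequence u below, whose recursion needs no
   division. *)
Section Existence.
Variables (R : comNzRingType) (s t e : R).

Definition division_step (u : nat -> R) (n : nat) : R :=
  let m := n./2 in
  if odd n then
    (if odd m then 1 else s ^+ 4) * u (m + 2)%N * u m ^+ 3
    - (if odd m then s ^+ 4 else 1) * u (m - 1)%N * u (m + 1)%N ^+ 3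
  else
    u (m - 1)%N ^+ 2 * u m * u (m + 2)%N
    - u (m - 2)%N * u m * u (m + 1)%N ^+ 2.

(* k is only fuel: the value does not depend on k as long as n < k. *)
Fixpoint division_aux (k n : nat) : R :=
  if k is k'.+1 then
    match n with
    | 0 => 0 | 1 => 1 | 2 => 1 | 3 => t | 4 => e
    | _ => division_step (division_aux k') n
    end
  else 0.

Lemma division_auxS k n : (4 < n)%N ->
  division_aux k.+1 n = division_step (division_aux k) n.
Proof. by case: n => [|[|[|[|[|n]]]]]. Qed.

Lemma division_aux_stable k l n :
  (n < k)%N -> (n < l)%N -> division_aux k n = division_aux l n.
Proof.
elim: k l n => [|k IH] [|l] n // nk nl.
have [n4|n4] := ltnP 4 n; last by case: n n4 {nk nl} => [|[|[|[|[|n]]]]].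
by rewrite !division_auxS // /division_step !(IH l) //; lia.
Qed.

Definition division_seq (n : nat) : R :=
  (if odd n then 1 else s) * division_aux n.+1 n.

Lemma division_seq_odd n : (2 <= n)%N ->
  division_seq (2 * n + 1)
    = division_seq (n + 2) * division_seq n ^+ 3
      - division_seq (n - 1) * division_seq (n + 1) ^+ 3.
Proof.
move=> n2; rewrite /division_seq.
have -> : odd (2 * n + 1) = true by lia.
have -> : odd (n + 2) = odd n by lia.
have -> : odd (n - 1) = ~~ odd n by lia.
have -> : odd (n + 1) = ~~ odd n by lia.
rewrite !(@division_aux_stable _ (2 * n + 1)%N (n + 2)) //; try lia.
rewrite !(@division_aux_stable _ (2 * n + 1)%N n) //; try lia.
rewrite !(@division_aux_stable _ (2 * n + 1)%N (n - 1)) //; try lia.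
rewrite !(@division_aux_stable _ (2 * n + 1)%N (n + 1)) //; try lia.
rewrite division_auxS; last by lia.
rewrite /division_step.
have -> : odd (2 * n + 1) = true by lia.
have -> : (2 * n + 1)./2 = n by lia.
by case: (odd n) => /=; ring.
Qed.

Lemma division_seq_even n : (3 <= n)%N ->
  division_seq (2 * n) * s
    = division_seq (n - 1) ^+ 2 * division_seq n * division_seq (n + 2)
      - division_seq (n - 2) * division_seq n * division_seq (n + 1) ^+ 2.
Proof.
move=> n3; rewrite /division_seq.
have -> : odd (2 * n) = false by lia.
have -> : odd (n + 2) = odd n by lia.
have -> : odd (n - 2) = odd n by lia.
have -> : odd (n - 1) = ~~ odd n by lia.
have -> : odd (n + 1) = ~~ odd n by lia.
rewrite !(@division_aux_stable _ (2 * n)%N (n + 2)) //; try lia.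
rewrite !(@division_aux_stable _ (2 * n)%N n) //; try lia.
rewrite !(@division_aux_stable _ (2 * n)%N (n - 1)) //; try lia.
rewrite !(@division_aux_stable _ (2 * n)%N (n - 2)) //; try lia.
rewrite !(@division_aux_stable _ (2 * n)%N (n + 1)) //; try lia.
rewrite division_auxS; last by lia.
rewrite /division_step.
have -> : odd (2 * n) = false by lia.
have -> : (2 * n)./2 = n by lia.
by case: (odd n) => /=; ring.
Qed.

End Existence.

Lemma division_sequence_exists (W : weierstrass) :
  {psi : nat -> {poly {poly int}} | is_division_sequence W psi}.
Proof.
have [e De] : {e | psi4 W = psi2 W * e} by eexists; reflexivity.
exists (division_seq (psi2 W) (psi3 W) e); split.
- by rewrite /division_seq mulr0.
- by split; rewrite /division_seq /= ?mul1r ?mulr1 ?De.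
- exact: division_seq_odd.
- exact: division_seq_even.
Qed.

Lemma psi2_neq0 (W : weierstrass) : psi2 W != 0.
Proof.
apply/eqP => psi20.
have : (psi2 W).[1] - (psi2 W).[0] = 2 by rewrite /psi2 !hornerE; ring.
by rewrite psi20 !horner0 subrr => /(congr1 (horner^~ 0)); rewrite !hornerE.
Qed.

Lemma division_sequence_unique (W : weierstrass) f g :
  is_division_sequence W f -> is_division_sequence W g -> f =1 g.
Proof.
move=> [f0 [f1 f2 f3 f4] fo fe] [g0 [g1 g2 g3 g4] go ge] n.
elim/ltn_ind: n => n IH.
case: (ltnP n 5) => [|n5].
  by case: n {IH} => [|[|[|[|[|n]]]]] // _; congruence.
have [on|en] := boolP (odd n).
  have -> : (n = 2 * n./2 + 1)%N by lia.
  by rewrite fo ?go ?IH //; lia.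
apply: (mulIf (psi2_neq0 W)).
have -> : (n = 2 * n./2)%N by lia.
by rewrite fe ?ge ?IH //; lia.
Qed.

Definition psi (W : weierstrass) : nat -> {poly {poly int}} :=
  sval (division_sequence_exists W).

Lemma psiP (W : weierstrass) : is_division_sequence W (psi W).
Proof. exact: svalP. Qed.

Definition phi (W : weierstrass) (n : nat) : {poly {poly int}} :=
  match n with
  | 0 => 1
  | 1 => 'X%:P
  | _ => 'X%:P * psi W n ^+ 2 - psi W (n + 1) * psi W (n - 1)
  end.

Definition eval_xy (p : {poly {poly int}}) (x0 y0 : int) : int :=
  p.[y0%:P].[x0].

(* G_n = phi_n(P) at the point P = (0, 0). *)
Definition G (W : weierstrass) (n : nat) : int := eval_xy (phi W n) 0 0.

(* y^2 + (1 - c) x y - b y = x^3 - b x^2 *)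
Definition tate (b c : int) : weierstrass := Weierstrass (1 - c) (- b) (- b) 0 0.

Definition E4 (a : int) : weierstrass := tate a 0.
Definition E5 (a : int) : weierstrass := tate a a.
Definition E6 (a : int) : weierstrass := tate (a + a ^+ 2) a.
Definition E7 (a : int) : weierstrass := tate (a ^+ 3 - a ^+ 2) (a ^+ 2 - a).
Definition E9 (a : int) : weierstrass :=
  let c := a ^+ 2 * (a - 1) in
  let b := c * (a * (a - 1) + 1) in
  tate b c.

(* For N = 10, 12 the parameters b, c of the Tate normal form are not integral
   and the equation has been rescaled. *)
Definition E10 (a : int) : weierstrass :=
  let beta := (2 * a - 1) * (a - 1) in
  let zeta := - a ^+ 2 + 3 * a - 1 in
  Weierstrass (zeta ^+ 2 - a * beta * zeta)
              (- (a ^+ 3 * beta * zeta ^+ 2))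
              (- (a ^+ 3 * beta * zeta ^+ 4)) 0 0.

Definition E12 (a : int) : weierstrass :=
  let lambda := (3 * a ^+ 2 - 3 * a + 1) * (a - 2 * a ^+ 2) in
  let theta := 2 * a - 2 * a ^+ 2 - 1 in
  Weierstrass ((a - 1) * ((a - 1) ^+ 3 - lambda))
              (- ((a - 1) ^+ 4 * lambda * theta))
              (- ((a - 1) ^+ 8 * lambda * theta)) 0 0.

(* Main.v *)
From HB Require Import structures.
Require Import Defs.
From Stdlib Require Import ZArith.
From mathcomp Require Import all_boot all_order all_algebra.
From mathcomp Require Import realalg ssrZ zify ring lra.
Set Implicit Arguments.
Unset Strict Implicit.
Unset Printing Implicit Defensive.
Import Order.TTheory GRing.Theory Num.Theory.
Local Open Scope ring_scope.

(** For each of the seven curves the value psi_n(P) at P = (0,0) is 0 or, up to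
sign, a product of powers of a few pairwise coprime integers f_1, ..., f_k, each
a polynomial in the parameter a. Since P has order N, the sequence psi_n(P) is
quasi-periodic, psi_(n+N) = psi_n w1^n w0 with w1, w0 again products of powers
of the f_i. Conversely, a sequence with this quasi-period that satisfies the
recurrences of the division polynomials on one period satisfies them everywhere
([eds_of_quasiperiod]), and the recurrences determine it from its first five
terms, psi_2(P) being nonzero ([eds_unique]); so one finite check per curve
proves the explicit formula ([psi_at0_td]). As x(P) = 0, the numerator is
G_n = - psi_(n+1) psi_(n-1), an explicit product of powers of the f_i up to
sign. Such a product is a square (up to sign) or a cube exactly when every f_i
whose exponent is not divisible by 2, respectively 3, is one ([zpower_prod]).
The residues of these exponents depend only on n modulo N, respectively 3N, and
can be tabulated ([power_tables]).

The theorem is thereby reduced to the question which of the f_i can be squares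
or cubes simultaneously. The conditions of the theorem concern a single f_i, or
the product of two of them; all other combinations that occur have to
be excluded for admissible a, which amounts to the following Diophantine
statements.
- a and a - 1 are not both e-th powers for e > 1 ([consecutive_powers]).
- a^2 - a + 1 lies strictly between consecutive squares, and so does
  a^2 - 3a + 1 between consecutive cubes if a is a cube
  ([quadratic_not_square], [no_two_cubes_quadratic]).
- Neither a nor a - 1 is a cube together with 2a - 1. This is Euler's theorem
  that x^3 + y^3 = 2 z^3 has only trivial solutions
  ([sum_of_cubes_twice_cube]), by descent in Z[sqrt(-3)].
- a^2 + (a - 1)^2 is not a cube, by factorization in the Gaussian integers
  ([gaussian_cube]).
- 2a - 1 and 2a^2 - 2a + 1 are not both squares, because s^4 + 1 = 2 t^2 forces
  s^2 = 1, by Fermat's theorem on right triangles of square area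
  ([quartic_twice_square]).
- 2a - 1 = s^3 and a^2 - 3a + 1 = t^3 is impossible ([no_two_cubes_golden]).
  Here 4 t^3 = (s^2 - s - 1)(s^4 + s^3 + 2 s^2 - s + 1), and a coprimality
  argument makes s^2 - s - 1, the norm of s - phi for the golden ratio phi, a
  cube. Factorization in Z[phi] turns this into the Thue equation
  x^3 + 3 x^2 y + y^3 = 1, whose left side is the norm of x + y eta for
  eta^3 = 3 eta^2 + 1. The units of norm 1 of Z[eta] are the powers of eta
  ([cubic_units]), and Skolem's method modulo 151 finds all of those without
  eta^2-coefficient ([thue]).

The three quadratic rings are handled by one lemma ([qnorm_cube]) that states
factorization of cubes for a norm form directly, with a descent on norms in
place of unique factorization. *)

(** * Perfect powers of integers *)

Definition power (e m : nat) : Prop := exists k, m = (k ^ e)%N.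

(** Prime valuations turn both the behaviour on coprime products and the behaviour
on powers into divisibility statements. *)
Lemma power_logn e m : (0 < e)%N -> (0 < m)%N ->
  power e m <-> (forall p, (e %| logn p m)%N).
Proof.
move=> e0 m0; split=> [[k ->] p|em]; first by rewrite lognX dvdn_mulr.
exists (\prod_(p <- primes m) p ^ (logn p m %/ e))%N.
rewrite {1}(prod_prime_decomp m0) prime_decompE big_map /=.
rewrite (big_morph (fun x => (x ^ e)%N) (fun x y => expnMn x y e) (exp1n e)).
by apply: eq_bigr => p _; rewrite -expnM divnK.
Qed.

Lemma power_mul_coprime e m n : (0 < e)%N -> (0 < m)%N -> (0 < n)%N ->
  coprime m n -> power e (m * n) <-> power e m /\ power e n.
Proof.
move=> e0 m0 n0 cmn; split; last first.
  by case=> [[k ->] [l ->]]; exists (k * l)%N; rewrite expnMn.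
move/(power_logn e0 (_ : 0 < m * n)%N); rewrite muln_gt0 m0 => /(_ n0) emn.
have em p : (logn p m == 0)%N || (logn p n == 0)%N.
  rewrite !eqn0Ngt !logn_gt0 -negb_and; apply/negP => /andP[pm pn].
  by move: cmn; rewrite coprime_has_primes // => /hasPn/(_ p pn) /=; rewrite pm.
split; apply/power_logn => // p; move: (emn p); rewrite lognM //.
  by case/orP: (em p) => /eqP ->; rewrite ?addn0.
by case/orP: (em p) => /eqP ->; rewrite ?addn0.
Qed.

Lemma power_expn e m a : prime e -> (0 < m)%N ->
  power e (m ^ a) <-> (e %| a)%N \/ power e m.
Proof.
move=> pe m0; have e0 := prime_gt0 pe; split; last first.
  case=> [/dvdnP[k ->]|[k ->]]; first by exists (m ^ k)%N; rewrite expnM.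
  by exists (k ^ a)%N; rewrite -!expnM mulnC.
move/(power_logn e0 (_ : 0 < m ^ a)%N); rewrite expn_gt0 m0 => /(_ isT) ema.
have [|na] := boolP (e %| a)%N; [by left|right].
apply/power_logn => // p; move: (ema p).
by rewrite lognX Euclid_dvdM // (negPf na).
Qed.

(** For e = 2 and e = 3 this is [is_square] and [is_cube]: squares are taken up to
sign, and -1 is a cube, so in both cases only the absolute value matters. *)
Definition zpower (e : nat) (m : int) : Prop := m != 0 /\ power e `|m|.

Lemma is_squareE m : is_square m <-> zpower 2 m.
Proof.
split=> [[k [k0 [->|->]]]|[m0 [k Ek]]].
- by split; [rewrite expf_neq0|exists `|k|%N; rewrite abszX].
- by split; [rewrite oppr_eq0 expf_neq0|exists `|k|%N; rewrite abszN abszX].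
rewrite -mulnn in Ek; exists k%:Z; split; last by lia.
apply: contra_neq m0 => k0; move: Ek; have -> : k = 0%N by lia.
by rewrite mul0n => /eqP; rewrite absz_eq0 => /eqP.
Qed.

Lemma is_cubeE m : is_cube m <-> zpower 3 m.
Proof.
split=> [[k [k0 ->]]|[m0 [k Ek]]].
  by split; [rewrite expf_neq0|exists `|k|%N; rewrite abszX].
have [r Er] : exists r : int, m = r ^+ 3.
  have [m_ge0|m_lt0] := leP 0 m; [exists k%:Z|exists (- k%:Z)].
    by rewrite !expnS expn0 in Ek; rewrite !exprS expr0; lia.
  by rewrite !expnS expn0 in Ek; rewrite !exprS expr0; lia.
by exists r; split=> //; apply: contra_neq m0 => r0; rewrite Er r0 expr0n.
Qed.

Lemma zpower_mul e x y : (0 < e)%N -> coprimez x y -> x != 0 -> y != 0 ->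
  zpower e (x * y) <-> zpower e x /\ zpower e y.
Proof.
move=> e0 cxy x0 y0; rewrite /zpower mulf_neq0 // x0 y0 abszM.
have -> : power e (`|x| * `|y|) <-> power e `|x| /\ power e `|y|.
  by apply: power_mul_coprime; rewrite ?absz_gt0 // -coprimezE.
by tauto.
Qed.

Lemma zpower_exp e x k : prime e -> x != 0 ->
  zpower e (x ^+ k) <-> (e %| k)%N \/ zpower e x.
Proof.
move=> pe x0; rewrite /zpower expf_neq0 // x0 abszX.
have : power e (`|x| ^ k) <-> (e %| k)%N \/ power e `|x|.
  by apply: power_expn; rewrite ?absz_gt0.
by have : true by []; tauto.
Qed.

Lemma zpower1 e : zpower e 1. Proof. by split=> //; exists 1%N; rewrite exp1n. Qed.

Lemma zpowerN e x : zpower e (- x) <-> zpower e x.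
Proof. by rewrite /zpower oppr_eq0 abszN. Qed.

Definition all_zpower (e : nat) (s : seq int) : Prop :=
  foldr (fun f Q => zpower e f /\ Q) True s.

(** The pairwise coprime powers [fs`_i ^+ E i] can be treated separately; one with
[e %| E i] is an e-th power for free, the others are e-th powers iff their base
is, as [e] is prime. *)
Lemma zpower_prod e (fs : seq int) (E : nat -> nat) : prime e ->
  all (fun f => f != 0) fs -> pairwise coprimez fs ->
  zpower e (\prod_(i < size fs) fs`_i ^+ E i)
    <-> all_zpower e (mask [seq ~~ (e %| E i)%N | i <- iota 0 (size fs)] fs).
Proof.
move=> pe; elim: fs E => [|f fs IH] E.
  by rewrite big_ord0 => _ _ /=; split=> // _; exact: zpower1.
move=> /= /andP[f0 fs0] /andP[/allP cf cfs]; rewrite big_ord_recl.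
under eq_bigr do rewrite lift0.
rewrite /=.
rewrite zpower_mul ?prime_gt0 ?expf_neq0 //; first last.
- apply/prodf_neq0 => i _.
  rewrite expf_neq0 //; apply: (allP fs0); exact: mem_nth.
- apply: coprimezXl; elim/big_rec: _ => [|i x _ cx]; first by rewrite coprimezE coprimen1.
  rewrite coprimezMr cx andbT coprimezXr //; apply: cf; exact: mem_nth.
rewrite zpower_exp // (IH (fun i => E i.+1)) //.
rewrite (iotaDl 1 0) -map_comp.
have := all_zpower e (mask [seq ~~ (e %| E i.+1)%N | i <- iota 0 (size fs)] fs).
case: (e %| E 0)%N => Q /=; rewrite -/(all_zpower e _).
  by split=> [[]//|]; split=> //; left.
by split=> [[[]]//|[]]; split=> //; right.
Qed.

(** * Cubes, coprimality and parity in the integers *)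

Lemma zpower3P m : zpower 3 m -> exists2 r : int, r != 0 & m = r ^+ 3.
Proof. by move/is_cubeE => [r [r0 ->]]; exists r. Qed.

Lemma zpower3_cube (r : int) : r != 0 -> zpower 3 (r ^+ 3).
Proof. by move=> r0; apply/is_cubeE; exists r. Qed.

Lemma zpower2_pos (m : int) : 0 < m -> zpower 2 m -> exists2 r : int, 0 < r & m = r ^+ 2.
Proof.
move=> m0 [_ [k Ek]]; exists k%:Z; rewrite -mulnn in Ek; last by rewrite expr2; lia.
by case: k Ek => [|k] Ek; lia.
Qed.

Lemma zpower2_square (r : int) : r != 0 -> zpower 2 (r ^+ 2).
Proof. by move=> r0; apply/is_squareE; exists r; split=> //; left. Qed.

Lemma cube_lt (x y : int) : x < y -> x ^+ 3 < y ^+ 3.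
Proof.
move=> xy; rewrite -subr_gt0.
have -> : y ^+ 3 - x ^+ 3 = (y - x) * (x ^+ 2 + x * y + y ^+ 2) by ring.
by rewrite mulr_gt0 ?subr_gt0 //; nia.
Qed.

Lemma cube_le (x y : int) : x <= y -> x ^+ 3 <= y ^+ 3.
Proof. by rewrite le_eqVlt => /predU1P[->|/cube_lt/ltW]. Qed.

Lemma cube_inj (x y : int) : x ^+ 3 = y ^+ 3 -> x = y.
Proof. by move=> E; case: (ltgtP x y) => // /cube_lt; rewrite E ltxx. Qed.

(** Signs can be absorbed, -1 being a cube; therefore coprime factors of a cube are
cubes themselves and not only up to units. *)
Lemma coprime_cubes (u v w : int) : coprimez u v -> w != 0 -> u * v = w ^+ 3 ->
  exists r s, [/\ u = r ^+ 3, v = s ^+ 3 & r * s = w].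
Proof.
move=> cuv w0 E; have uv0 : u * v != 0 by rewrite E expf_neq0.
move: (uv0); rewrite mulf_eq0 negb_or => /andP[u0 v0].
have : zpower 3 (u * v) by rewrite E; exact: zpower3_cube.
case/(zpower_mul (e := 3) isT cuv u0 v0) => /zpower3P[r r0 Er] /zpower3P[s s0 Es].
exists r, s; split=> //; move: E; rewrite Er Es -exprMn; exact: cube_inj.
Qed.

Lemma coprimezMDl k m n : coprimez m (k * m + n) = coprimez m n.
Proof. by rewrite /coprimez gcdzMDl. Qed.

Lemma parity (x : int) : exists i, x = 2 * i \/ x = 2 * i + 1.
Proof. by exists (x %/ 2)%Z; lia. Qed.

Lemma coprimez_2 (x i : int) : x = 2 * i + 1 -> coprimez 2 x.
Proof. by move=> ->; rewrite [2 * i]mulrC coprimezMDl. Qed.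

Lemma coprimez_3 (x : int) : ~~ (3 %| x)%Z -> coprimez 3 x.
Proof. by move=> x3; rewrite coprimezE /= prime_coprime. Qed.

Lemma coprimez_bezout (x y u v : int) : u * x + v * y = 1 -> coprimez x y.
Proof. by move=> E; apply/coprimezP; exists (u, v). Qed.

(** Hence a^2 - a + 1, a^2 - 3a + 1, 2a^2 - 2a + 1 and 3a^2 - 3a + 1 are odd, in
particular nonzero, for every a. *)
Lemma even_mul_pred (a : int) : exists w, a * (a - 1) = 2 * w.
Proof.
have [i [->|->]] := parity a; first by exists (i * (2 * i - 1)); ring.
by exists (i * (2 * i + 1)); ring.
Qed.

(** * Binary quadratic norm forms and cubes *)

(** The hypothesis is what Euclidean division provides: k may be changed modulo m so
that the norm of k - tau is nonzero and smaller than m^2. The predicate P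
restricts the moduli and has to be inherited by the cofactor d; it is needed for
Z[sqrt(-3)], which is not a principal ideal domain but behaves like one at odd
moduli. *)
Section NormForm.
Variables t n : int.

(** The norm of x + y tau in Z[tau], where tau^2 = t tau - n. In particular
[qnorm k (-1)] is the minimal polynomial of tau at k. *)
Definition qnorm (x y : int) : int := x ^+ 2 + t * x * y + n * y ^+ 2.

Variable P : pred nat.
Hypothesis reduction : forall (m : nat) (k : int), (1 < m)%N -> P m ->
  exists k' : int,
  [/\ (m %| k - k')%Z, qnorm k' (-1) != 0, (`|qnorm k' (-1)| < m ^ 2)%N
    & forall d, (d * m = `|qnorm k' (-1)|)%N -> P d].

(** Descent on m. The kernel of Z[tau] -> Z/m, tau |-> k, contains k' - tau, whose
norm is c m' with |c| = m and m' < m. By induction k' - tau is divisible by an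
element x + y tau of norm m' up to sign; the quotient has norm m up to sign and
lies in the kernel. *)
Lemma qnorm_represents (m : nat) (k : int) :
  (0 < m)%N -> P m -> (m %| qnorm k (-1))%Z ->
  exists x y : int, `|qnorm x y|%N = m /\ (m %| x + y * k)%Z.
Proof.
elim/ltn_ind: m k => m IH k m0 Pm mk.
have [m1|m1] := leqP m 1.
  have -> : m = 1%N by lia.
  by exists 1, 0; rewrite dvd1z; split=> //; rewrite /qnorm; lia.
have [k' [kk' N0 Nlt Pd]] := reduction k m1 Pm.
have /dvdzP[q Dq] : (m %| qnorm k' (-1))%Z.
  have [w Dw] := dvdzP kk'.
  have Ek : k = k' + w * m by rewrite -Dw; ring.
  have -> : qnorm k' (-1) = qnorm k (-1) - w * (k + k' - t) * m.
    by rewrite /qnorm Ek; ring.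
  by rewrite rpredB ?dvdz_mull.
have [c [m' [Dc Dm' Ecm]]] : exists c (m' : nat),
    [/\ `|c|%N = m, (m' * m = `|qnorm k' (-1)|)%N & c * m' = qnorm k' (-1)].
  exists (sgz q * m), `|q|%N; rewrite Dq; split.
  - have q0 : q != 0 by apply: contraNneq N0 => q0; rewrite Dq q0 mul0r.
    by rewrite abszM absz_sg q0 mul1n.
  - by rewrite abszM.
  - by rewrite [RHS]mulrC [in RHS](intEsg q); ring.
have m'0 : (0 < m')%N.
  by case: m' Dm' {Ecm} => // /esym/eqP; rewrite mul0n absz_eq0 (negPf N0).
have lt_m' : (m' < m)%N by nia.
have [||x [y [Exy /dvdzP[z Dz]]]] := IH m' lt_m' k' m'0.
- exact: Pd.
- by rewrite -Ecm dvdz_mull.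
have Ex : x = z * m' - y * k' by rewrite -Dz; ring.
have En : n = c * m' - k' ^+ 2 + t * k' by rewrite Ecm /qnorm; ring.
exists (z * k' - y * c), (- z); split.
  have : qnorm (z * k' - y * c) (- z) * m' = c * qnorm x y.
    by rewrite /qnorm Ex En; ring.
  move/(congr1 absz); rewrite !abszM Dc Exy => /eqP.
  by rewrite eqn_pmul2r // => /eqP.
have -> : z * k' - y * c + - z * k = - (z * (k - k')) - y * c by ring.
rewrite rpredB ?rpredN ?dvdz_mull // ?(dvdz_mull z kk') //.
by rewrite dvdzE Dc /=.
Qed.

(** (u + v tau)^3 = cube_re u v + cube_im u v tau. *)
Definition cube_re u v := u ^+ 3 - 3 * n * u * v ^+ 2 - t * n * v ^+ 3.
Definition cube_im u v :=
  3 * u ^+ 2 * v + 3 * t * u * v ^+ 2 + (t ^+ 2 - n) * v ^+ 3.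

(** An element x + y tau with coprime coordinates whose norm is a cube is a unit
e + f tau times a cube. The choice of k with p^3 | x + y k makes tau |-> k a ring
homomorphism onto the integers modulo p^3 that kills x + y tau. Take u + v tau
of norm p up to sign in the kernel modulo p; its cube is killed modulo p^3.
Therefore x + y tau times the conjugate of that cube is divisible by p^3, and
the quotient has norm 1 or -1. *)
Lemma qnorm_cube (x y p : int) :
  coprimez x y -> p != 0 -> P `|p|%N -> qnorm x y = p ^+ 3 ->
  exists e f u v : int,
  [/\ `|qnorm e f|%N = 1%N,
      x = e * cube_re u v - n * f * cube_im u v
    & y = e * cube_im u v + f * cube_re u v + t * f * cube_im u v].
Proof.
move=> cxy p0 Pp Exy.
have cyp : coprimez (p ^+ 3) y.
  apply/coprimezP; have /coprimezP[[i j] /= Eij] : coprimez (x ^+ 2) y.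
    exact: coprimezXl.
  exists (i, j - i * (t * x + n * y)) => /=.
  by rewrite -Exy -Eij /qnorm; ring.
have [[i j] /= Eij] := coprimezP _ _ cyp.
pose k := - x * j.
have Ek : x + y * k = x * i * p ^+ 3.
  have -> : x + y * k = x * 1 - x * (j * y) by rewrite /k; ring.
  by rewrite -Eij; ring.
have /dvdzP[s Ds] : (p ^+ 3 %| qnorm k (-1))%Z.
  rewrite -(Gauss_dvdzr _ (coprimezXr 2 cyp)); apply/dvdzP.
  (* y^2 times the norm of k - tau is the norm of x + y tau modulo x + y k. *)
  exists (1 - (t * y + 2 * x) * x * i + (x * i) ^+ 2 * p ^+ 3).
  have E1 : y * k = x * i * p ^+ 3 - x by rewrite -Ek; ring.
  have E2 : y ^+ 2 * qnorm k (-1) = (y * k) ^+ 2 - t * y * (y * k) + n * y ^+ 2.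
    by rewrite /qnorm; ring.
  have -> : y ^+ 2 * qnorm k (-1) = (x * i) ^+ 2 * p ^+ 6
      - (t * y + 2 * x) * x * i * p ^+ 3 + qnorm x y.
    by rewrite E2 E1 /qnorm; ring.
  by rewrite Exy; ring.
have [||u [v [Euv /dvdzP[w Dw]]]] := @qnorm_represents `|p|%N k _ Pp.
- by rewrite lt0n absz_eq0.
- have : (p %| qnorm k (-1))%Z by rewrite Ds exprS mulrCA dvdz_mulr.
  by rewrite !dvdzE.
have /dvdzP[{}w {}Dw] : (p %| u + v * k)%Z.
  have : (`|p|%N %| u + v * k)%Z by rewrite Dw dvdz_mull.
  by rewrite !dvdzE.
set A := cube_re u v; set B := cube_im u v.
have [r Dr] : exists r, A + B * k = r * p ^+ 3.
  exists (w ^+ 3 - s * (3 * u * v ^+ 2 + v ^+ 3 * (k + t))).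
  have -> : A + B * k = (u + v * k) ^+ 3
     - qnorm k (-1) * (3 * u * v ^+ 2 + v ^+ 3 * (k + t)).
    by rewrite /A /B /cube_re /cube_im /qnorm; ring.
  by rewrite Dw Ds; ring.
have NAB : qnorm A B = qnorm u v ^+ 3.
  by rewrite /A /B /cube_re /cube_im /qnorm; ring.
have [sg [Esg sg2]] : exists sg : int, qnorm u v = sg * p /\ sg ^+ 2 = 1.
  have : qnorm u v = p \/ qnorm u v = - p by lia.
  by case=> ->; [exists 1 | exists (-1)]; split; ring.
(* e + f tau is (x + y tau) times the conjugate of A + B tau, divided by p^3. *)
pose e := x * i * (A + t * B) - y * k * r + y * B * s.
pose f := y * r - B * (x * i).
have Ee : e * p ^+ 3 = x * (A + t * B) + n * y * B.
  have -> : e * p ^+ 3 = x * i * p ^+ 3 * (A + t * B)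
      - y * k * (r * p ^+ 3) + y * B * (s * p ^+ 3) by rewrite /e; ring.
  by rewrite -Ek -Dr -Ds /qnorm; ring.
have Ef : f * p ^+ 3 = y * A - x * B.
  have -> : f * p ^+ 3 = y * (r * p ^+ 3) - B * (x * i * p ^+ 3).
    by rewrite /f; ring.
  by rewrite -Ek -Dr; ring.
have p3 : p ^+ 3 != 0 by rewrite expf_neq0.
exists (sg * e), (sg * f), u, v; rewrite -/A -/B; split.
- have : qnorm e f * (p ^+ 3) ^+ 2 = sg * (p ^+ 3) ^+ 2.
    have -> : qnorm e f * (p ^+ 3) ^+ 2 = qnorm (e * p ^+ 3) (f * p ^+ 3).
      by rewrite /qnorm; ring.
    rewrite Ee Ef; have -> : qnorm (x * (A + t * B) + n * y * B) (y * A - x * B)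
       = qnorm x y * qnorm A B by rewrite /qnorm; ring.
    rewrite NAB Exy Esg; have -> : (sg * p) ^+ 3 = sg ^+ 2 * sg * p ^+ 3 by ring.
    by rewrite sg2; ring.
  move/(mulIf (expf_neq0 2 p3)) => Nef.
  have -> : qnorm (sg * e) (sg * f) = sg ^+ 2 * qnorm e f by rewrite /qnorm; ring.
  by rewrite Nef sg2 mul1r; move: sg2; clear; nia.
- apply: (mulIf p3).
  have -> : (sg * e * A - n * (sg * f) * B) * p ^+ 3
     = sg * ((e * p ^+ 3) * A - n * (f * p ^+ 3) * B) by ring.
  have -> : sg * (e * p ^+ 3 * A - n * (f * p ^+ 3) * B) = x * (sg * qnorm A B).
    by rewrite Ee Ef /qnorm; ring.
  rewrite NAB Esg; have -> : sg * (sg * p) ^+ 3 = (sg ^+ 2) ^+ 2 * p ^+ 3 by ring.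
  by rewrite sg2; ring.
- apply: (mulIf p3).
  have -> : (sg * e * B + sg * f * A + t * (sg * f) * B) * p ^+ 3
     = sg * ((e * p ^+ 3) * B + (f * p ^+ 3) * A + t * (f * p ^+ 3) * B) by ring.
  rewrite Ee Ef.
  have -> : sg * ((x * (A + t * B) + n * y * B) * B + (y * A - x * B) * A
        + t * (y * A - x * B) * B) = y * (sg * qnorm A B).
    by rewrite /qnorm; ring.
  rewrite NAB Esg; have -> : sg * (sg * p) ^+ 3 = (sg ^+ 2) ^+ 2 * p ^+ 3 by ring.
  by rewrite sg2; ring.
Qed.
End NormForm.

(** * The equation x^3 + y^3 = 2 z^3 *)

(** For odd m the representative k' can be taken even and of absolute value below
m. Then k'^2 + 3 is odd, so the cofactor stays odd. *)
Lemma qnorm3_reduction (m : nat) (k : int) : (1 < m)%N -> odd m ->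
  exists k' : int,
  [/\ (m %| k - k')%Z, qnorm 0 3 k' (-1) != 0, (`|qnorm 0 3 k' (-1)| < m ^ 2)%N
    & forall d, (d * m = `|qnorm 0 3 k' (-1)|)%N -> odd d].
Proof.
move=> m1 om; pose r := (k %% m)%Z; pose q := (k %/ m)%Z.
have Ek : k = q * m + r by exact: divz_eq.
have r0 : 0 <= r by apply: modz_ge0; lia.
have rm : r < m by apply: ltz_pmod; lia.
have [k' [i [dk Ek' bd]]] : exists k' i : int,
    [/\ (m %| k - k')%Z, k' = 2 * i & - m%:Z < k' < m].
  have [i [Ei|Ei]] := parity r.
    exists r, i; split; [|exact: Ei|lia].
    by rewrite Ek addrK dvdz_mull.
  have [j Ej] : exists j, m%:Z = 2 * j + 1 by exists (m./2)%:Z; lia.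
  exists (r - m%:Z), (i - j); split; [|lia|lia].
  have -> : k - (r - m%:Z) = (q + 1) * m%:Z by rewrite Ek; ring.
  by rewrite dvdz_mull.
have EN : qnorm 0 3 k' (-1) = k' * k' + 3 by rewrite /qnorm; ring.
exists k'; rewrite EN; split=> //.
- by nia.
- by rewrite -mulnn; nia.
- by move=> d; case: (boolP (odd d)) => // ed; rewrite Ek'; nia.
Qed.

Lemma cube_of_norm3 (x y d : int) : coprimez x y -> d != 0 -> odd `|d| ->
  x ^+ 2 + 3 * y ^+ 2 = d ^+ 3 ->
  exists u v, x = u ^+ 3 - 9 * u * v ^+ 2 /\ y = 3 * u ^+ 2 * v - 3 * v ^+ 3.
Proof.
move=> cxy d0 od E.
have [|e [f [u [v [Eef -> ->]]]]] := qnorm_cube qnorm3_reduction cxy d0 od.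
  by rewrite -E /qnorm; ring.
rewrite /cube_re /cube_im.
have [f0 e1] : f = 0 /\ (e = 1 \/ e = -1).
  by move: Eef; rewrite /qnorm; nia.
exists (e * u), (e * v); rewrite f0.
by case: e1 => ->; split; ring.
Qed.

Lemma coprime_cubes3 (u v w c : int) :
  coprimez u v -> coprimez u w -> coprimez v w -> c != 0 ->
  u * v * w = c ^+ 3 ->
  exists r s t, [/\ u = r ^+ 3, v = s ^+ 3, w = t ^+ 3 & r * s * t = c].
Proof.
move=> cuv cuw cvw c0 E.
have cuvw : coprimez (u * v) w by rewrite coprimezMl cuw.
have [m [t [Em Et Ec]]] := coprime_cubes cuvw c0 E.
have m0 : m != 0 by apply: contraNneq c0 => m0; rewrite -Ec m0 mul0r.
have [r [s [Er Es Erm]]] := coprime_cubes cuv m0 Em.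
by exists r, s, t; split; rewrite // Erm.
Qed.

Lemma sqr_sub_eq_add (x y : int) : (x - y) ^+ 2 = (x + y) ^+ 2 -> x = 0 \/ y = 0.
Proof.
move=> E; have /eqP : x * y = 0 by lia.
by rewrite mulf_eq0 => /orP[] /eqP; [left|right].
Qed.

(** A common factor of u and v, or 2 if u and v have equal parity, would divide
both coordinates of the cube (u + v sqrt(-3))^3. *)
Lemma norm3_params_coprime (u v : int) :
  coprimez (u ^+ 3 - 9 * u * v ^+ 2) (3 * u ^+ 2 * v - 3 * v ^+ 3) ->
  coprimez u v /\ (exists i, u + v = 2 * i + 1).
Proof.
move=> c; split.
  have Eu : u ^+ 3 - 9 * u * v ^+ 2 = u * (u ^+ 2 - 9 * v ^+ 2) by ring.
  have Ev : 3 * u ^+ 2 * v - 3 * v ^+ 3 = v * (3 * u ^+ 2 - 3 * v ^+ 2) by ring.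
  by move: c; rewrite Eu Ev coprimezMl !coprimezMr -!andbA => /and3P[].
have [i [Ei|Ei]] := parity (u + v); last by exists i.
have Eu : u = 2 * i - v by lia.
move: c; have -> : u ^+ 3 - 9 * u * v ^+ 2
   = 2 * (4 * i ^+ 3 - 6 * i ^+ 2 * v - 6 * i * v ^+ 2 + 4 * v ^+ 3).
  by rewrite Eu; ring.
have -> : 3 * u ^+ 2 * v - 3 * v ^+ 3 = 2 * (6 * i ^+ 2 * v - 6 * i * v ^+ 2).
  by rewrite Eu; ring.
by rewrite coprimezMl !coprimezMr.
Qed.

Lemma norm3_ge4 (p q : int) : p != 0 -> q != 0 -> 4 <= p ^+ 2 + 3 * q ^+ 2.
Proof. by move=> p0 q0; nia. Qed.

Lemma odd_norm3_root (p q d i : int) :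
  p + q = 2 * i + 1 -> p ^+ 2 + 3 * q ^+ 2 = d ^+ 3 -> odd `|d|.
Proof.
move=> Epq; have [j [Ej|Ej]] := parity d; last by move=> _; lia.
have -> : p = 2 * i + 1 - q by lia.
by rewrite Ej; lia.
Qed.

Lemma proper_factor_lt (C r d : int) :
  C * r * d != 0 -> 4 <= d ^+ 3 -> (`|C| < `|(C * r * d)%R|)%N.
Proof.
rewrite !mulf_eq0 !negb_or -!absz_gt0 !abszM => /andP[/andP[C0 r0] d0] d4.
have d2 : (1 < `|d|)%N.
  rewrite ltnNge; apply/negP => d1; have : d = 1 \/ d = -1 by lia.
  by case=> d_1; move: d4; rewrite d_1.
by rewrite -mulnA ltn_Pmulr // (leq_trans d2) // leq_pmull.
Qed.

(** Euler's descent. Both x and y are odd, x = p + q and y = p - q, so that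
p (p^2 + 3 q^2) = z^3, and p q = 0 has to be shown.
If 3 does not divide p, both factors are cubes c^3 and d^3, and the second gives
p = u (u - 3v) (u + 3v) with pairwise coprime factors C^3, A^3, B^3; then
A^3 + B^3 = 2 C^3.
If p = 3 p', the coprime factors are 9 p' and q^2 + 3 p'^2, and
p' = 3 v (u - v) (u + v) gives B^3 - A^3 = 2 C^3 in the same way.
In both cases C divides z properly, because d is at least 2. *)
Lemma sum_of_cubes_twice_cube (x y z : int) :
  coprimez x y -> x ^+ 3 + y ^+ 3 = 2 * z ^+ 3 -> x ^+ 2 = y ^+ 2.
Proof.
have [k] := ubnP `|z|%N; elim: k x y z => // k IH x y z ltz cxy E.
have [[p [q [Ex Ey]]] [i Ei]] : (exists p q, x = p + q /\ y = p - q)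
    /\ exists i, x = 2 * i + 1.
  have [i [Ei|Ei]] := parity x; have [j [Ej|Ej]] := parity y.
  - by move: cxy; rewrite Ei Ej coprimezMl !coprimezMr.
  - by move: E; rewrite Ei Ej; lia.
  - by move: E; rewrite Ei Ej; lia.
  - by split; [exists (i + j + 1), (i - j); lia | exists i].
have cpq : coprimez p q.
  have /coprimezP[[a b] /= Eab] : coprimez (p + q) (p - q) by rewrite -Ex -Ey.
  by apply/coprimezP; exists (a + b, a - b); rewrite /= -Eab; ring.
have Ez : p * (p ^+ 2 + 3 * q ^+ 2) = z ^+ 3.
  apply: (@mulfI _ 2) => //; rewrite -E Ex Ey; ring.
suff pq0 : p * q = 0.
  have -> : x ^+ 2 = y ^+ 2 + 4 * (p * q) by rewrite Ex Ey; ring.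
  by rewrite pq0 mulr0 addr0.
have [->|p0] := eqVneq p 0; first by rewrite mul0r.
have [->|q0] := eqVneq q 0; first by rewrite mulr0.
have N4 : 4 <= p ^+ 2 + 3 * q ^+ 2 by exact: norm3_ge4.
have N0 : p ^+ 2 + 3 * q ^+ 2 != 0 by rewrite gt_eqF // (lt_le_trans _ N4).
have z0 : z != 0.
  by apply: contraNneq (mulf_neq0 p0 N0) => z0; rewrite Ez z0.
have Epq : p + q = 2 * i + 1 by rewrite -Ei.
have lt_root (c d C r : int) : 4 <= d ^+ 3 ->
    c * d = z -> c = C * r -> (`|C| < k)%N.
  move=> Ed Ecd Ec; apply: (@leq_trans `|z|%N); last by rewrite -ltnS.
  rewrite -Ecd Ec.
  apply: proper_factor_lt => //.
  by rewrite -Ec Ecd.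
have [/dvdzP[p' Ep]|np] := boolP (3 %| p)%Z; last first.
  have cpN : coprimez p (p ^+ 2 + 3 * q ^+ 2).
    rewrite expr2 coprimezMDl coprimezMr coprimezXr // andbT.
    by rewrite coprimez_sym coprimez_3.
  have [c [d [Ec Ed Ecd]]] := coprime_cubes cpN z0 Ez.
  have d0 : d != 0 by apply: contraNneq z0 => d0; rewrite -Ecd d0 mulr0.
  have [u [v [Eu Ev]]] := cube_of_norm3 cpq d0 (odd_norm3_root Epq Ed) Ed.
  have [cuv [j Ej]] : coprimez u v /\ exists i, u + v = 2 * i + 1.
    by apply: norm3_params_coprime; rewrite -Eu -Ev.
  have c0 : c != 0 by apply: contraNneq z0 => c0; rewrite -Ecd c0 mul0r.
  have nu : coprimez u 3.
    rewrite coprimez_sym coprimez_3 //; apply: contra np => u3.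
    have -> : p = u * (u ^+ 2 - 9 * v ^+ 2) by rewrite Eu; ring.
    exact: dvdz_mulr.
  have cu3v : coprimez u (3 * v) by rewrite coprimezMr nu.
  have c1 : coprimez u (u - 3 * v).
    by have := coprimezMDl 1 u (- (3 * v)); rewrite mul1r coprimezN => ->.
  have c2 : coprimez u (u + 3 * v).
    by have := coprimezMDl 1 u (3 * v); rewrite mul1r => ->.
  have c3 : coprimez (u - 3 * v) (u + 3 * v).
    have -> : u + 3 * v = 1 * (u - 3 * v) + 2 * (3 * v) by ring.
    rewrite coprimezMDl coprimezMr [coprimez _ 2]coprimez_sym.
    rewrite (@coprimez_2 _ (j - 2 * v)) /=; last first.
      have -> : u - 3 * v = (u + v) - 4 * v by ring.
      by rewrite Ej; ring.
    rewrite coprimez_sym; have -> : u - 3 * v = (- 1) * (3 * v) + u by ring.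
    by rewrite coprimezMDl coprimez_sym.
  have [|C [A [B [EC EA EB EABC]]]] := coprime_cubes3 c1 c2 c3 c0.
    by rewrite -Ec Eu; ring.
  have cAB : coprimez A B.
    by move: c3; rewrite EA EB coprimez_pexpl // coprimez_pexpr.
  have : A ^+ 2 = B ^+ 2.
    apply: (IH A B C) => //; last by rewrite -EA -EB -EC; ring.
    apply: (lt_root c d C (A * B)) => //; first by rewrite -Ed.
    by rewrite -EABC mulrA.
  move/(congr1 (fun t => t ^+ 3)); rewrite -!exprM ![(2 * 3)%N]mulnC !exprM -EA -EB.
  case/sqr_sub_eq_add => [u0|v0]; first by rewrite Eu u0; ring.
  have {}v0 : v = 0 by apply: (@mulfI _ 3); rewrite // mulr0.
  by rewrite Ev v0; ring.
have nq : coprimez q 3.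
  rewrite coprimez_sym coprimez_3 //; apply/negP => /dvdzP[q' Eq'].
  by move: cpq; rewrite Ep Eq' coprimezMl !coprimezMr andbC => /andP[/andP[]].
have Ez' : (9 * p') * (q ^+ 2 + 3 * p' ^+ 2) = z ^+ 3 by rewrite -Ez Ep; ring.
have Ep3 : p = 3 * p' by rewrite Ep mulrC.
have cp'q : coprimez p' q by move: cpq; rewrite Ep coprimezMl => /andP[].
have cpN : coprimez (9 * p') (q ^+ 2 + 3 * p' ^+ 2).
  have -> : 9 * p' = 3 ^+ 2 * p' by ring.
  rewrite coprimezMl; apply/andP; split; last first.
    have -> : q ^+ 2 + 3 * p' ^+ 2 = (3 * p') * p' + q ^+ 2 by ring.
    by rewrite coprimezMDl coprimezXr.
  rewrite coprimezXl //.
  have -> : q ^+ 2 + 3 * p' ^+ 2 = (p' ^+ 2) * 3 + q ^+ 2 by ring.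
  by rewrite coprimezMDl coprimezXr // coprimez_sym.
have [c [d [Ec Ed Ecd]]] := coprime_cubes cpN z0 Ez'.
have d0 : d != 0 by apply: contraNneq z0 => d0; rewrite -Ecd d0 mulr0.
have c0 : c != 0 by apply: contraNneq z0 => c0; rewrite -Ecd c0 mul0r.
have od : odd `|d|.
  by apply: (@odd_norm3_root q p' d (i - p')) Ed; rewrite -[q](addKr p) Epq Ep3; ring.
have cqp' : coprimez q p' by rewrite coprimez_sym.
have [u [v [Eu Ev]]] := cube_of_norm3 cqp' d0 od Ed.
have [cuv [j Ej]] : coprimez u v /\ exists i, u + v = 2 * i + 1.
  by apply: norm3_params_coprime; rewrite -Eu -Ev.
have cvu : coprimez v u by rewrite coprimez_sym.
have c1 : coprimez v (u - v).
  have -> : u - v = (- 1) * v + u by ring.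
  by rewrite coprimezMDl.
have c2 : coprimez v (u + v).
  have -> : u + v = 1 * v + u by ring.
  by rewrite coprimezMDl.
have c3 : coprimez (u - v) (u + v).
  have -> : u + v = 1 * (u - v) + 2 * v by ring.
  rewrite coprimezMDl coprimezMr [coprimez _ 2]coprimez_sym.
  rewrite (@coprimez_2 _ (j - v)) /=; last first.
    have -> : u - v = (u + v) - 2 * v by ring.
    by rewrite Ej; ring.
  by rewrite coprimez_sym.
have [c' Ec'] : exists c', c = 3 * c'.
  have : (3 %| c ^+ 3)%Z by rewrite -Ec; apply/dvdzP; exists (3 * p'); ring.
  rewrite dvdzE abszX Euclid_dvdX // andbT -[3%N]/(`|3%:Z|%N) -dvdzE.
  by case/dvdzP => c' ->; exists c'; rewrite mulrC.
have c'0 : c' != 0 by apply: contraNneq c0 => c'0; rewrite Ec' c'0 mulr0.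
have [|C [A [B [EC EA EB EABC]]]] := coprime_cubes3 c1 c2 c3 c'0.
  apply: (@mulfI _ 27) => //.
  have -> : 27 * c' ^+ 3 = c ^+ 3 by rewrite Ec'; ring.
  by rewrite -Ec Ev; ring.
have cBA : coprimez B (- A).
  move: c3; rewrite EA EB coprimez_pexpl // coprimez_pexpr // coprimezN.
  by rewrite coprimez_sym.
have : B ^+ 2 = (- A) ^+ 2.
  apply: (IH B (- A) C) => //; last first.
    have -> : (- A) ^+ 3 = - A ^+ 3 by ring.
    by rewrite -EA -EB -EC; ring.
  apply: (lt_root c d C (3 * A * B)) => //.
    by rewrite -Ed norm3_ge4 //; apply: contraNneq p0 => p'0; rewrite Ep3 p'0 mulr0.
  by rewrite Ec' -EABC; ring.
move/(congr1 (fun t => t ^+ 3)).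
have -> : ((- A) ^+ 2) ^+ 3 = (A ^+ 3) ^+ 2 by ring.
have -> : (B ^+ 2) ^+ 3 = (B ^+ 3) ^+ 2 by ring.
rewrite -EA -EB => /esym/sqr_sub_eq_add[u0|v0]; first by rewrite Eu u0; ring.
by rewrite Ep3 Ev v0; ring.
Qed.

(** * The equation x^2 + (x - 1)^2 = t^3 *)

(** The least residue works for the Gaussian integers and for Z[phi]: both forms
r^2 + 1 and r^2 - r - 1 are smaller than m^2 in absolute value and nonzero for
0 <= r < m. *)
Lemma small_norm_reduction (t n : int) :
  (t, n) \in [:: (0, 1); (1, -1)] ->
  forall (m : nat) (k : int), (1 < m)%N -> xpredT m ->
  exists k' : int,
  [/\ (m %| k - k')%Z, qnorm t n k' (-1) != 0, (`|qnorm t n k' (-1)| < m ^ 2)%N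
    & forall d, (d * m = `|qnorm t n k' (-1)|)%N -> xpredT d].
Proof.
move=> tn m k m1 _; exists (k %% m)%Z.
have m0 : m%:Z != 0 by lia.
have r0 := modz_ge0 k m0.
have rm : (k %% m)%Z < m by apply: ltz_pmod; lia.
split=> //.
- by rewrite {1}(divz_eq k m) addrK dvdz_mull.
- move: (k %% m)%Z r0 {rm} => r r0; move: tn; rewrite !inE /qnorm.
  case/orP => /eqP[-> ->]; apply/eqP; first by nia.
  have [r1|r1] := leP r 1; last by nia.
  have : r = 0 \/ r = 1 by lia.
  by case=> ->.
rewrite -mulnn; move: (k %% m)%Z r0 rm => r r0 rm; move: tn; rewrite !inE /qnorm.
by case/orP => /eqP[-> ->]; nia.
Qed.

Lemma factor_of_unit (x y w : int) :
  (w = 1 \/ w = -1) -> x * y = w -> x = 1 \/ x = -1.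
Proof.
move=> w1 /(congr1 absz); rewrite abszM => E.
have : (`|x| * `|y| == 1)%N by rewrite E; case: w1 => ->.
by rewrite muln_eq1 => /andP[/eqP x1 _]; lia.
Qed.

(** a + (a - 1) i is a unit times (u + v i)^3 = R + I i, so that the difference 1 of
its coordinates is R - I or R + I up to sign. Both factor,
R - I = (u + v) ((u + v)^2 - 6uv) and R + I = (u - v) ((u - v)^2 + 6uv), which
forces uv = 0, and then R I = 0 and a (a - 1) = 0. *)
Lemma gaussian_cube (a t : int) : t != 0 -> a ^+ 2 + (a - 1) ^+ 2 = t ^+ 3 ->
  a * (a - 1) = 0.
Proof.
move=> t0 E.
have ca : coprimez a (a - 1).
  have -> : a - 1 = 1 * a + (- 1) by ring.
  by rewrite coprimezMDl coprimezE /= coprimen1.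
have [|e [f [u [v [Eef Ea Eb]]]]] :=
    qnorm_cube (@small_norm_reduction 0 1 isT) ca t0 isT.
  by rewrite -E /qnorm; ring.
pose R := u * (u ^+ 2 - 3 * v ^+ 2); pose I := v * (3 * u ^+ 2 - v ^+ 2).
have {}Ea : a = e * R - f * I by rewrite Ea /cube_re /cube_im /R /I; ring.
have {}Eb : a - 1 = e * I + f * R by rewrite Eb /cube_re /cube_im /R /I; ring.
have key (w : int) : (w = 1 \/ w = -1) ->
    ((u + v) * ((u + v) ^+ 2 - 6 * (u * v)) = w \/
     (u - v) * ((u - v) ^+ 2 + 6 * (u * v)) = w) -> u * v = 0.
  move: (u * v) (u + v) (u - v) => q r s w1 [] H.
    by have r1 := factor_of_unit w1 H; case: r1 H => ->; case: w1 => ->; clear; lia.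
  by have r1 := factor_of_unit w1 H; case: r1 H => ->; case: w1 => ->; clear; lia.
have units : (e = 0 /\ (f = 1 \/ f = -1)) \/ (f = 0 /\ (e = 1 \/ e = -1)).
  by move: Eef; rewrite /qnorm; clear; nia.
have uv0 : u * v = 0.
  have Ed : e * R - f * I - (e * I + f * R) = 1 by rewrite -Ea -Eb; ring.
  have F1 : (u + v) * ((u + v) ^+ 2 - 6 * (u * v)) = R - I by rewrite /R /I; ring.
  have F2 : (u - v) * ((u - v) ^+ 2 + 6 * (u * v)) = R + I by rewrite /R /I; ring.
  have {}key w : w = 1 \/ w = -1 -> R - I = w \/ R + I = w -> u * v = 0.
    by move=> w1; rewrite -F1 -F2; exact: key.
  move: key Ed; clear -units; move: R I (u * v) => r i q.
  case: units => [] [-> []] -> key Ed.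
  - by apply: (key (-1)); [right|right; lia].
  - by apply: (key 1); [left|right; lia].
  - by apply: (key 1); [left|left; lia].
  - by apply: (key (-1)); [right|left; lia].
have RI : R * I = 0.
  have -> : R * I = u * v * ((u ^+ 2 - 3 * v ^+ 2) * (3 * u ^+ 2 - v ^+ 2)).
    by rewrite /R /I; ring.
  by rewrite uv0 mul0r.
have -> : a * (a - 1) = (e ^+ 2 - f ^+ 2) * (R * I) + e * f * (R ^+ 2 - I ^+ 2).
  by rewrite Eb Ea; ring.
by rewrite RI; case: units => [] [-> _]; ring.
Qed.

(** * Units of the cubic ring of discriminant -135 and a Thue equation *)

Delimit Scope Z_scope with BZ.

(** The triple (a, b, c) stands for a + b eta + c eta^2 with eta^3 = 3 eta^2 + 1.
The binary integers Z make the computations modulo 151 feasible. *)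
Definition cubic : Type := (Z * Z * Z)%type.
HB.instance Definition _ := GRing.Zmodule.copy cubic (Z * Z * Z)%type.

Definition cubic_mul (u v : cubic) : cubic :=
  let: (a, b, c) := u in let: (d, e, f) := v in
  let p3 := b * f + c * e in let p4 := c * f in
  (a * d + p3 + 3 * p4, a * e + b * d + p4,
   a * f + b * e + c * d + 3 * p3 + 9 * p4).

Fact cubic_mulA : associative cubic_mul.
Proof.
by move=> [[a b] c] [[d e] f] [[g h] i]; congr (_, _, _); ring.
Qed.

Fact cubic_mulC : commutative cubic_mul.
Proof. by move=> [[a b] c] [[d e] f]; congr (_, _, _); ring. Qed.

Fact cubic_mul1 : left_id ((1, 0, 0) : cubic) cubic_mul.
Proof. by move=> [[a b] c]; congr (_, _, _); ring. Qed.

Fact cubic_addE a b c d e f :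
  (a, b, c) + (d, e, f) = (a + d, b + e, c + f) :> cubic.
Proof. by []. Qed.

Fact cubic_mulDl : left_distributive cubic_mul +%R.
Proof.
move=> [[a b] c] [[d e] f] [[g h] i].
by rewrite cubic_addE /cubic_mul cubic_addE; congr (_, _, _); ring.
Qed.

Fact cubic_1neq0 : ((1, 0, 0) : cubic) != 0.
Proof. by []. Qed.

HB.instance Definition _ := GRing.Zmodule_isComNzRing.Build cubic
  cubic_mulA cubic_mulC cubic_mul1 cubic_mulDl cubic_1neq0.

Lemma cubic_mulE a b c d e f :
  ((a, b, c) : cubic) * ((d, e, f) : cubic) =
  (a * d + (b * f + c * e) + 3 * (c * f), a * e + b * d + c * f,
   a * f + b * e + c * d + 3 * (b * f + c * e) + 9 * (c * f)) :> cubic.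
Proof. by []. Qed.

Definition coef2 (u : cubic) : Z := u.2.
Lemma coef2D u v : coef2 (u + v) = coef2 u + coef2 v. Proof. by []. Qed.

Lemma coef2_natl n u : coef2 (n%:R * u) = n%:R * coef2 u.
Proof.
rewrite !mulr_natl; elim: n => [|n IH]; first by rewrite !mulr0n.
by rewrite !mulrS coef2D IH.
Qed.

(** The binomial theorem truncated after the quadratic term, in a form that holds
over any commutative ring. *)
Lemma expr1D3 (R : comNzRingType) (x : R) n : exists z,
  (1 + x) ^+ n = 1 + n%:R * x + 'C(n, 2)%:R * x ^+ 2 + x ^+ 3 * z.
Proof.
elim: n => [|n [z IH]]; first by exists 0; rewrite expr0 bin0n /=; ring.
exists (z + x * z + 'C(n, 2)%:R).
by rewrite exprS IH binS bin1 natrD -[n.+1]add1n natrD; ring.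
Qed.

(** The 151-adic logarithm in elementary form: writing j = 151^e c with c prime to
151, each power of 151 in j contributes exactly one more factor 151. *)
Lemma skolem_expansion (R : comNzRingType) (xi : R) j : (0 < j)%N ->
  exists e c z, ~~ (151 %| c)%N /\
    (1 + 151 * xi) ^+ j = 1 + (151 ^ e.+1)%:R * (c%:R * xi + 151 * z).
Proof.
elim/ltn_ind: j => j IH j0.
have [/dvdnP[k Dj]|ndvd] := boolP (151 %| j)%N; last first.
  have [z ->] := expr1D3 (151 * xi) j.
  exists 0%N, j, ('C(j, 2)%:R * xi ^+ 2 + 151 * xi ^+ 3 * z).
  by split=> //; rewrite expn1; ring.
have [||e [c [z [cn Ez]]]] := IH k; [lia|lia|].
rewrite Dj exprM Ez; set w := _ * xi + _; set P : R := (151 ^ e)%:R.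
have -> : (151 ^ e.+1)%:R = 151 * P :> R by rewrite expnS natrM.
have [y ->] := expr1D3 (151 * P * w) 151.
exists e.+1, c, (z + 75 * P * w ^+ 2 + P ^+ 2 * w ^+ 3 * y); split=> //.
have -> : 'C(151, 2) = (151 * 75)%N by rewrite bin2.
rewrite !expnS !natrM -/P {1}/w; ring.
Qed.

(** In the expansion of the power, the eta^2-coefficient is 151^(e+1) times a number
congruent to c [coef2 (B * xi)] modulo 151. The hypothesis says that i inverts
[coef2 (B * xi)] modulo 151, so this number is not 0. *)
Lemma skolem_only_at_0 (xi B : cubic) (i k : Z) j :
  coef2 B = 0 -> i * coef2 (B * xi) = 1 + 151 * k ->
  coef2 (B * (1 + 151 * xi) ^+ j) = 0 -> j = 0%N.
Proof.
move=> B0 Bxi; case: (posnP j) => // j0.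
have [e [c [z [cn ->]]]] := skolem_expansion xi j0.
set q := (151 ^ _)%N.
have -> : B * (1 + q%:R * (c%:R * xi + 151 * z))
   = B + q%:R * (c%:R * (B * xi) + 151%:R * (B * z)) by ring.
rewrite coef2D coef2_natl coef2D !coef2_natl B0 add0r => /eqP.
rewrite mulf_eq0 => /orP[/eqP q0|/eqP E].
  have : (0 < q)%N by rewrite expn_gt0.
  lia.
case/negP: cn.
have : c%:R * (i * coef2 (B * xi)) = - 151 * (i * coef2 (B * z)).
  have -> : c%:R * (i * coef2 (B * xi)) = i * (c%:R * coef2 (B * xi)) by ring.
  have -> : c%:R * coef2 (B * xi) = - (151 * coef2 (B * z)).
    by apply/eqP; rewrite -addr_eq0 E.
  ring.
rewrite Bxi; move: (coef2 _) => t; lia.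
Qed.

Definition eta : cubic := (0, 1, 0).
Definition inv_eta : cubic := (0, -3, 1).
Lemma etaV : eta * inv_eta = 1. Proof. by []. Qed.

(** Factors congruent to 1 modulo 151 do not change the coefficient modulo 151. *)
Lemma coef2_mod151 (u xi : cubic) n r :
  coef2 (u ^+ r * (1 + 151 * xi) ^+ n) = 0 -> Z.modulo (coef2 (u ^+ r)) 151 = 0.
Proof.
have [z ->] : exists z, (1 + 151 * xi) ^+ n = 1 + 151 * z.
  elim: n => [|n [z IH]]; first by exists 0; rewrite expr0; ring.
  by exists (z + xi + 151 * xi * z); rewrite exprS IH; ring.
have -> : u ^+ r * (1 + 151 * z) = u ^+ r + 151%:R * (u ^+ r * z) by ring.
rewrite coef2D coef2_natl; move: (coef2 _) (coef2 _) => t s E.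
have -> : s = Z.mul (Z.opp t) 151 by lia.
exact: Z_mod_mult.
Qed.

(** (eta^25 - 1) / 151. The prime 151 is chosen because eta has the small order 25
modulo 151, and among the residues r modulo 25 only those that come from an
exponent with vanishing eta^2-coefficient (0, 1 and -2) survive. *)
Definition xi_eta : cubic :=
  (411696128%BZ, 132642463%BZ, 1277823843%BZ).
(** (eta^(-25) - 1) / 151. *)
Definition xi_inv_eta : cubic := ((-7312)%BZ, 10584%BZ, (-2651)%BZ).
Lemma eta25 : eta ^+ 25 = 1 + 151 * xi_eta.
Proof. by apply/eqP; vm_compute. Qed.

Lemma inv_eta25 : inv_eta ^+ 25 = 1 + 151 * xi_inv_eta.
Proof. by apply/eqP; vm_compute. Qed.

Lemma coef2_zero_residues (u xi : cubic) (rs : seq nat) k :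
  u ^+ 25 = 1 + 151 * xi ->
  all (fun r => (Z.modulo (coef2 (u ^+ r)) 151 == 0) ==> (r \in rs)) (iota 0 25) ->
  coef2 (u ^+ k) = 0 -> (k %% 25 \in rs)%N.
Proof.
move=> u25 /allP allr; rewrite {1}(divn_eq k 25) addnC exprD mulnC exprM u25.
move=> /coef2_mod151 tr.
by apply: (implyP (allr (k %% 25)%N _)); rewrite ?tr // mem_iota ltn_pmod.
Qed.

(** Modulo 151 the exponent is 0, 1 or 23 modulo 25. In each class Skolem's method
leaves one exponent: 0, 1, and -2 in the class of 23, which is not a natural
number. *)
Lemma coef2_eta_zero k : coef2 (eta ^+ k) = 0 -> k = 0%N \/ k = 1%N.
Proof.
move=> tk; have : (k %% 25 \in [:: 0; 1; 23])%N.
  by apply: (coef2_zero_residues eta25 _ tk); vm_compute.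
rewrite !inE; set j := (k %/ 25)%N.
have Dk := divn_eq k 25.
have Ek : eta ^+ k = eta ^+ (k %% 25) * (1 + 151 * xi_eta) ^+ j.
  by rewrite -eta25 -exprM {1}Dk addnC exprD mulnC.
case/or3P => /eqP kr; rewrite kr in Dk Ek.
- have j0 : j = 0%N.
    apply: (@skolem_only_at_0 xi_eta 1 9%BZ 76161686%BZ); [by vm_compute..|].
    by rewrite -(expr0 eta) -Ek.
  by left; lia.
- have j0 : j = 0%N.
    apply: (@skolem_only_at_0 xi_eta eta 92%BZ 2416440313%BZ); [by vm_compute..|].
    by rewrite -{1}(expr1 eta) -Ek.
  by right; lia.
- have // : j.+1 = 0%N.
  apply: (@skolem_only_at_0 xi_eta (inv_eta ^+ 2) 97%BZ 85207410%BZ); [by vm_compute..|].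
  rewrite [_ ^+ j.+1]exprS mulrA; have -> : inv_eta ^+ 2 * (1 + 151 * xi_eta) = eta ^+ 23.
    by apply/eqP; vm_compute.
  by rewrite -Ek.
Qed.

(** The same argument for negative exponents of eta: the classes 0, 2 and 24 modulo
25 contain the exceptional exponents 0, 2 and -1 of 1 / eta. *)
Lemma coef2_inv_eta_zero k : coef2 (inv_eta ^+ k) = 0 -> k = 0%N \/ k = 2%N.
Proof.
move=> tk.
have : (k %% 25 \in [:: 0; 2; 24])%N.
  by apply: (coef2_zero_residues inv_eta25 _ tk); vm_compute.
rewrite !inE; set j := (k %/ 25)%N.
have Dk := divn_eq k 25.
have Ek : inv_eta ^+ k = inv_eta ^+ (k %% 25) * (1 + 151 * xi_inv_eta) ^+ j.
  by rewrite -inv_eta25 -exprM {1}Dk addnC exprD mulnC.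
case/or3P => /eqP kr; rewrite kr in Dk Ek.
- have j0 : j = 0%N.
    apply: (@skolem_only_at_0 xi_inv_eta 1 142%BZ (-2493)%BZ); [by vm_compute..|].
    by rewrite -(expr0 inv_eta) -Ek.
  by left; lia.
- have j0 : j = 0%N.
    apply: (@skolem_only_at_0 xi_inv_eta (inv_eta ^+ 2) 54%BZ 3785%BZ); [by vm_compute..|].
    by rewrite -Ek.
  by right; lia.
- have // : j.+1 = 0%N.
  apply: (@skolem_only_at_0 xi_inv_eta eta 59%BZ 1028%BZ); [by vm_compute..|].
  rewrite [_ ^+ j.+1]exprS mulrA; have -> : eta * (1 + 151 * xi_inv_eta) = inv_eta ^+ 24.
    by apply/eqP; vm_compute.
  by rewrite -Ek.
Qed.

(** The determinant of multiplication by a + b eta + c eta^2. *)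
Definition cubic_norm (u : cubic) : Z :=
  let: (a, b, c) := u in
  a ^+ 3 + 3 * a ^+ 2 * b + 9 * a ^+ 2 * c - 3 * a * b * c - 6 * a * c ^+ 2
  + b ^+ 3 + 3 * b ^+ 2 * c + c ^+ 3.

Lemma cubic_normM u v : cubic_norm (u * v) = cubic_norm u * cubic_norm v.
Proof.
by case: u v => [[a b] c] [[d e] f]; rewrite cubic_mulE /cubic_norm; ring.
Qed.

Lemma cubic_normX u n : cubic_norm u = 1 -> cubic_norm (u ^+ n) = 1.
Proof.
by move=> u1; elim: n => [|n IH] //; rewrite exprS cubic_normM u1 IH mulr1.
Qed.

(** The polynomial X^3 - 3 X^2 - 1 has one real root h and two complex conjugate
roots. *)
Section RealPlace.
Variable h : realalg.
Hypotheses (hE : h ^+ 3 = 3 * h ^+ 2 + 1) (hl : 31 / 10 < h) (hu : h < 311 / 100).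

Definition z2r (z : Z) : realalg := (int_of_Z z)%:~R.
Lemma z2rD a b : z2r (a + b) = z2r a + z2r b.
Proof. by rewrite /z2r !rmorphD. Qed.

Lemma z2rM a b : z2r (a * b) = z2r a * z2r b.
Proof. by rewrite /z2r !rmorphM. Qed.

Lemma z2rN a : z2r (- a) = - z2r a.
Proof. by rewrite /z2r !rmorphN. Qed.

Lemma z2rX a n : z2r (a ^+ n) = z2r a ^+ n.
Proof. by rewrite /z2r !rmorphXn. Qed.

Lemma z2rn n : z2r n%:R = n%:R.
Proof. by rewrite /z2r !rmorph_nat. Qed.

Lemma z2r1 : z2r 1%R = 1.
Proof. by rewrite /z2r !rmorph1. Qed.

Lemma z2r0 : z2r 0%R = 0.
Proof. by rewrite /z2r !rmorph0. Qed.

Definition z2rE := (z2rD, z2rM, z2rN, z2rX, z2rn).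

Definition place (u : cubic) : realalg :=
  let: (a, b, c) := u in z2r a + z2r b * h + z2r c * h ^+ 2.

(** The squared absolute value of the image of u under a complex embedding, as the
sum of the squares of real and imaginary part. The complex roots have sum
s = 3 - h and product p = h^2 - 3 h, hence imaginary part the square root of
p - s^2 / 4 up to sign. *)
Definition conj_norm (u : cubic) : realalg :=
  let: (a, b, c) := u in
  let s := 3 - h in let p := h ^+ 2 - 3 * h in
  (z2r a + z2r b * s / 2 + z2r c * (s ^+ 2 / 2 - p)) ^+ 2
  + (p - s ^+ 2 / 4) * (z2r b + s * z2r c) ^+ 2.

Lemma placeM u v : place (u * v) = place u * place v.
Proof.
case: u v => [[a b] c] [[d e] f].
by rewrite cubic_mulE /place !z2rE; ring: hE.
Qed.

Lemma place_1 : place 1 = 1.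
Proof. by rewrite /place -[(1 : cubic)]/((1, 0, 0) : cubic) /z2r; ring. Qed.

Lemma placeX u n : place (u ^+ n) = place u ^+ n.
Proof. by elim: n => [|n IH]; rewrite ?place_1 // !exprS placeM IH. Qed.

Lemma place_eta : place eta = h.
Proof. by rewrite /place /eta /z2r; ring. Qed.

Lemma place_norm u : place u * conj_norm u = z2r (cubic_norm u).
Proof.
case: u => [[a b] c]; rewrite /place /conj_norm /cubic_norm !z2rE.
by field: hE.
Qed.

Lemma z2r_lt a b : (z2r a < z2r b) = (a < b).
Proof. by rewrite /z2r ltr_int; apply/idP/idP; lia. Qed.

Lemma z2r_lt1 a : -1 < z2r a < 1 -> a = 0.
Proof.
by have := z2r_lt (-1)%R a; have := z2r_lt a 1%R; rewrite z2rN z2r1 => -> ->; lia.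
Qed.

Lemma z2r_lt2 a : -2 < z2r a < 2 -> -1 <= a <= 1.
Proof.
by have := z2r_lt (-2)%R a; have := z2r_lt a 2%R; rewrite z2rN z2rn => -> ->; lia.
Qed.

Lemma small_units (a b : Z) : -1 <= a <= 1 -> -1 <= b <= 1 ->
  cubic_norm (a, b, 0) = 1 -> (a, b) = (1, 0) \/ (a, b) = (0, 1).
Proof.
move=> a_bd b_bd.
have: a = -1 \/ (a = 0 \/ a = 1) by lia.
have: b = -1 \/ (b = 0 \/ b = 1) by lia.
by case=> [->|[]->] [->|[]->] //; [left | right].
Qed.

Lemma conj_norm_ge0 u : 0 <= conj_norm u.
Proof.
case: u => [[a b] c]; rewrite /conj_norm addr_ge0 ?sqr_ge0 // mulr_ge0 ?sqr_ge0 //.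
by move: hl hu; nra.
Qed.

Lemma sqr_le_bound (x M : realalg) : 0 <= M -> x ^+ 2 <= M ^+ 2 -> - M <= x <= M.
Proof. by move=> M0 xM; apply/andP; split; nra. Qed.

(** The norm is the product of [place] and [conj_norm]; so [conj_norm u] is at most
1, and all real and complex embeddings of u are bounded. The bounds leave
c = 0 and a, b between -1 and 1. *)
Lemma unit_in_fundamental_domain u :
  cubic_norm u = 1 -> 1 <= place u -> place u < h -> u = 1.
Proof.
move=> u1 v1 vh.
have Q1 : conj_norm u <= 1.
  have := place_norm u; rewrite u1 /z2r rmorph1 => E.
  by move: v1 E (conj_norm_ge0 u); move: (place u) (conj_norm u) => v q; nra.
case: u u1 v1 vh Q1 => [[a b] c] u1 v1 vh.
rewrite /conj_norm.
set s := 3 - h; set p := h ^+ 2 - 3 * h.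
set A := z2r a in v1 vh *; set B := z2r b in v1 vh *; set C := z2r c in v1 vh *.
set X := A + _ + _; set W := B + _; set k := p - _ => Q1.
have k_lb : 306 / 1000 <= k by rewrite /k /p /s; move: hl hu; nra.
have X_bd : - 1 <= X <= 1 by apply: sqr_le_bound; first lra; nra.
have W_bd : - (181 / 100) <= W <= 181 / 100.
  apply: sqr_le_bound; first lra.
  have : 306 / 1000 * W ^+ 2 <= 1.
    have : 306 / 1000 * W ^+ 2 <= k * W ^+ 2 by rewrite ler_wpM2r ?sqr_ge0.
    by have := sqr_ge0 X; lra.
  by lra.
have decomp : A + B * h + C * h ^+ 2 = X + W * (h - s / 2) + C * ((h - s / 2) ^+ 2 + k).
  by rewrite /X /W /k /p /s; field.
have slope : 0 <= h - s / 2 <= 3165 / 1000 by rewrite /s; move: hl hu; lra.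
have curv : 1022 / 100 <= (h - s / 2) ^+ 2 + k.
  have -> : (h - s / 2) ^+ 2 + k = 3 * h ^+ 2 - 6 * h by rewrite /k /p /s; field.
  by move: hl hu; nra.
have Wslope : - (573 / 100) <= W * (h - s / 2) <= 573 / 100.
  by move: slope W_bd; move: (h - s / 2) => t; nra.
have C_bd : -1 < C < 1.
  move: v1 vh; rewrite /place -/A -/B -/C decomp => v1 vh.
  move: curv Wslope X_bd hu v1 vh; move: (_ ^+ 2 + k) (W * _) => t w.
  by nra.
have c0 : c = 0 by apply: z2r_lt1.
have C0 : C = 0 by rewrite /C c0 z2r0.
have WB : W = B by rewrite /W C0 mulr0 addr0.
have b_bd : -1 <= b <= 1.
  by apply: z2r_lt2; rewrite -/B -WB; move: W_bd; clear; lra.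
have a_bd : -1 <= a <= 1.
  have XA : A = X - B * s / 2 by rewrite /X C0; field.
  apply: z2r_lt2; rewrite -/A XA -WB; move: X_bd W_bd slope; rewrite /s.
  by move: hl hu; clear; nra.
rewrite c0 in u1 vh *; case: (small_units a_bd b_bd u1) => -[Ea Eb].
  by rewrite Ea Eb.
by move: vh; rewrite Ea Eb [place _]place_eta ltxx.
Qed.

Lemma place_gt0 u : cubic_norm u = 1 -> 0 < place u.
Proof.
move=> u1; have := place_norm u; rewrite u1 /z2r rmorph1.
by have := conj_norm_ge0 u; move: (place u) (conj_norm u) => v q; nra.
Qed.

Lemma place_inv_eta : place inv_eta = h^-1.
Proof.
apply: (mulfI (_ : h != 0)); first by apply/eqP; move: hl; lra.
rewrite -{1}place_eta -placeM etaV place_1 divff //; apply/eqP.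
by move: hl; lra.
Qed.

(** Dividing by eta often enough brings the real embedding into [1, h). *)
Lemma large_unit_is_power n u : cubic_norm u = 1 ->
  1 <= place u -> place u < h ^+ n -> exists k, u = eta ^+ k.
Proof.
elim: n u => [|n IH] u u1 v1 vh.
  by move: v1; rewrite leNgt -(expr0 h) vh.
have [vlt|vge] := ltP (place u) h.
  by exists 0%N; rewrite expr0 (unit_in_fundamental_domain u1 v1 vlt).
have h0 : 0 < h by move: hl; lra.
have [||| k Ek] := IH (u * inv_eta).
- by rewrite cubic_normM u1.
- by rewrite placeM place_inv_eta ler_pdivlMr // mul1r.
- by rewrite placeM place_inv_eta ltr_pdivrMr // -exprSr.
exists k.+1; rewrite exprS -Ek mulrCA etaV mulr1 //.
Qed.

Lemma eta_power_unbounded (x : realalg) : exists n, x < h ^+ n.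
Proof.
pose m := Num.bound `|x|; exists m; apply: (@lt_le_trans _ _ m%:R).
  exact: le_lt_trans (ler_norm x) (archi_boundP (normr_ge0 x)).
elim: m => [|n IH]; first by rewrite expr0 ler01.
rewrite -natr1 exprS; have : 1 <= h ^+ n by apply: exprn_ege1; move: hl; lra.
by move: IH hl; move: (n%:R) (h ^+ n) => s t; nra.
Qed.

(** A power of eta makes the unit large, so [large_unit_is_power] applies. *)
Lemma cubic_unit_place u : cubic_norm u = 1 ->
  (exists k, u = eta ^+ k) \/ (exists k, u = inv_eta ^+ k).
Proof.
move=> u1; have v0 := place_gt0 u1.
have [n Hn] := eta_power_unbounded (place u)^-1.
have w1 : cubic_norm (u * eta ^+ n) = 1.
  by rewrite cubic_normM u1 mul1r cubic_normX.
have [m Hm] := eta_power_unbounded (place (u * eta ^+ n)).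
have [|k Ek] := large_unit_is_power w1 _ Hm.
  rewrite placeM placeX place_eta -(mulfV (lt0r_neq0 v0)) ler_wpM2l //.
    exact: ltW v0.
  exact: ltW Hn.
have Eu : u = eta ^+ k * inv_eta ^+ n.
  by rewrite -Ek -mulrA -exprMn etaV expr1n mulr1.
have [le_nk|lt_kn] := leqP n k; [left; exists (k - n)%N|right; exists (n - k)%N].
  by rewrite Eu -{1}(subnK le_nk) exprD -mulrA -exprMn etaV expr1n mulr1.
rewrite Eu -{1}(subnK (ltnW lt_kn)) exprD mulrCA -exprMn etaV expr1n mulr1 //.
Qed.
End RealPlace.

Lemma real_eta : exists h : realalg,
  [/\ h ^+ 3 = 3 * h ^+ 2 + 1, 31 / 10 < h & h < 311 / 100].
Proof.
pose p : {poly realalg} := 'X^3 - 3 *: 'X^2 - 1.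
have pE x : p.[x] = x ^+ 3 - 3 * x ^+ 2 - 1 by rewrite /p !hornerE.
have [||h /andP[h1 h2] /rootP] := @poly_ivt _ p (31 / 10) (311 / 100).
- lra.
- by rewrite !pE; apply/andP; split; lra.
rewrite pE => h0; exists h.
have hE : h ^+ 3 = 3 * h ^+ 2 + 1 by lra.
split=> //; rewrite lt_neqAle ?h1 ?h2 andbT; apply/eqP => Dh.
  by move: hE; rewrite -Dh; lra.
by move: hE; rewrite Dh; lra.
Qed.

Lemma cubic_units u : cubic_norm u = 1 ->
  (exists k, u = eta ^+ k) \/ (exists k, u = inv_eta ^+ k).
Proof. by have [h [hE hl hu]] := real_eta; exact: (cubic_unit_place hE hl hu). Qed.

(** x + y eta has norm 1, so it is a power of eta or of 1 / eta without
eta^2-coefficient: 1, eta or eta^(-2) = -3 + eta. *)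
Lemma thue_Z (x y : Z) : x ^+ 3 + 3 * x ^+ 2 * y + y ^+ 3 = 1 ->
  [\/ (x, y) = (1, 0), (x, y) = (0, 1) | (x, y) = (-3, 1)].
Proof.
move=> E; pose u : cubic := (x, y, 0).
have u1 : cubic_norm u = 1 by rewrite -E /cubic_norm; ring.
case: (cubic_units u1) => -[k Ek].
  have : coef2 (eta ^+ k) = 0 by rewrite -Ek.
  by case/coef2_eta_zero => k0; move: Ek; rewrite k0 => -[-> ->]; [apply: Or31|apply: Or32].
have : coef2 (inv_eta ^+ k) = 0 by rewrite -Ek.
by case/coef2_inv_eta_zero => k0; move: Ek; rewrite k0 => -[-> ->]; [apply: Or31|apply: Or33].
Qed.

Lemma thue (x y : int) : x ^+ 3 + 3 * x ^+ 2 * y + y ^+ 3 = 1 ->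
  [\/ (x, y) = (1, 0), (x, y) = (0, 1) | (x, y) = (-3, 1)].
Proof.
move=> /(congr1 Z_of_int); rewrite !(rmorphD, rmorphXn, rmorphM) /= => E.
have -> : x = int_of_Z (Z_of_int x) by rewrite Z_of_intK.
have -> : y = int_of_Z (Z_of_int y) by rewrite Z_of_intK.
by case: (thue_Z E) => -[-> ->]; [apply: Or31|apply: Or32|apply: Or33].
Qed.

(** * The equation s^2 - s - 1 = p^3 *)

Local Notation golden_re := (cube_re 1 (-1)).
Local Notation golden_im := (cube_im 1 (-1)).

(** With phi^2 = phi + 1: x + y phi is phi^j times the cube of u + v phi, for j = 0,
1 or 2. *)
Definition golden_cube_class (x y : int) : Prop :=
  exists u v, [\/ x = golden_re u v /\ y = golden_im u v,
                  x = golden_im u v /\ y = golden_re u v + golden_im u v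
                | x = golden_re u v + golden_im u v /\ y = golden_re u v + 2 * golden_im u v].

(** Multiplication by phi; phi^3 is the cube of phi. *)
Lemma golden_class_mul x y : golden_cube_class x y -> golden_cube_class y (x + y).
Proof.
case=> u [v []] [-> ->].
- by exists u, v; apply: Or32.
- by exists u, v; apply: Or33; split; ring.
- by exists v, (u + v); apply: Or31; rewrite /cube_re /cube_im; split; ring.
Qed.

(** Multiplication by 1 / phi = phi - 1. *)
Lemma golden_class_div x y : golden_cube_class x y -> golden_cube_class (y - x) x.
Proof.
case=> u [v []] [-> ->].
- exists (v - u), u; apply: Or33; rewrite /cube_re /cube_im; split; ring.
- by exists u, v; apply: Or31; split; ring.
- by exists u, v; apply: Or32; split; ring.
Qed.

(** Units of Z[phi] are, up to sign, powers of phi. Descent on |e| + |f|: a unit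
e + f phi gets smaller after division by phi if e and f have the same sign, and
after multiplication by phi if they have opposite signs. *)
Lemma golden_unit_class e f u v : `|qnorm 1 (-1) e f|%N = 1%N ->
  golden_cube_class (e * golden_re u v + f * golden_im u v)
                    (e * golden_im u v + f * golden_re u v + f * golden_im u v).
Proof.
have [k] := ubnP (`|e| + `|f|)%N; elim: k e f => // k IH e f ltk Nef.
set A := golden_re u v; set B := golden_im u v.
have [e0|e0] := eqVneq e 0.
  have f1 : f = 1 \/ f = -1 by move: Nef; rewrite e0 /qnorm; clear; nia.
  exists (f * u), (f * v); apply: Or32; rewrite e0 /A /B /cube_re /cube_im.
  by case: f1 => ->; split; ring.
have [f0|f0] := eqVneq f 0.
  have e1 : e = 1 \/ e = -1 by move: Nef; rewrite f0 /qnorm; clear; nia.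
  exists (e * u), (e * v); apply: Or31; rewrite f0 /A /B /cube_re /cube_im.
  by case: e1 => ->; split; ring.
have {}Nef : e ^+ 2 + e * f - f ^+ 2 = 1 \/ e ^+ 2 + e * f - f ^+ 2 = -1.
  by move: Nef; rewrite /qnorm; clear; lia.
have [same|opp] := ltP 0 (e * f).
  have lt1 : (`|(f - e)%R| + `|e| < k)%N.
    have : (`|(f - e)%R| < `|f|)%N by move: e0 f0 Nef same; clear; nia.
    by move: ltk; clear; lia.
  have N1 : `|qnorm 1 (-1) (f - e) e|%N = 1%N.
    have -> : qnorm 1 (-1) (f - e) e = - (e ^+ 2 + e * f - f ^+ 2).
      by rewrite /qnorm; ring.
    by case: Nef => ->.
  have := golden_class_mul (IH _ _ lt1 N1); rewrite -/A -/B.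
  have -> : (f - e) * A + e * B + ((f - e) * B + e * A + e * B)
          = e * B + f * A + f * B by ring.
  have -> : (f - e) * B + e * A + e * B = e * A + f * B by ring.
  by [].
have lt1 : (`|f| + `|(e + f)%R| < k)%N.
  have : (`|(e + f)%R| < `|e|)%N by move: e0 f0 Nef opp; clear; nia.
  by move: ltk; clear; lia.
have N1 : `|qnorm 1 (-1) f (e + f)|%N = 1%N.
  have -> : qnorm 1 (-1) f (e + f) = - (e ^+ 2 + e * f - f ^+ 2).
    by rewrite /qnorm; ring.
  by case: Nef => ->.
have := golden_class_div (IH _ _ lt1 N1); rewrite -/A -/B.
have -> : f * B + (e + f) * A + (e + f) * B - (f * A + (e + f) * B)
          = e * A + f * B by ring.
have -> : f * A + (e + f) * B = e * B + f * A + f * B by ring.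
by [].
Qed.

Lemma even_mul_add (u v : int) : exists w, u * v * (u + v) = 2 * w.
Proof.
have [i [->|->]] := parity u; have [j [->|->]] := parity v.
- by exists (4 * i * j * (i + j)); ring.
- by exists (i * (2 * j + 1) * (2 * i + 2 * j + 1)); ring.
- by exists (j * (2 * i + 1) * (2 * i + 2 * j + 1)); ring.
- by exists ((2 * i + 1) * (2 * j + 1) * (i + j + 1)); ring.
Qed.

(** s - phi is phi^j times the cube of u + v phi. The phi-coordinate
3uv (u + v) + 2v^3 of the cube is even, but it would be -1 for j = 0 and the odd
number s for j = 1. For j = 2 the coordinate -1 gives the Thue equation for
-(u + v) and -v; its solution (-3, 1) is responsible for s = 37, where indeed
37^2 - 37 - 1 = 11^3. *)
Lemma golden_cube (s p i : int) : s = 2 * i + 1 -> p != 0 ->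
  s ^+ 2 - s - 1 = p ^+ 3 -> [\/ s = 1, s = -1 | s = 37].
Proof.
move=> Es p0 Ep.
have cs : coprimez s (-1) by rewrite coprimezE /= coprimen1.
have [|e [f [u [v [Nef Ea Eb]]]]] :=
    qnorm_cube (@small_norm_reduction 1 (-1) isT) cs p0 isT.
  by rewrite -Ep /qnorm; ring.
have : golden_cube_class s (-1).
  have := golden_unit_class u v Nef.
  have -> : e * golden_re u v + f * golden_im u v = s by rewrite [RHS]Ea; ring.
  have -> : e * golden_im u v + f * golden_re u v + f * golden_im u v = -1.
    by rewrite [RHS]Eb; ring.
  by [].
case=> {Ea Eb e f Nef p0 Ep p cs} {}u [{}v []] [E1 E2].
- have [w Ew] := even_mul_add u v.
  have E3 : -1 = 3 * (u * v * (u + v)) + 2 * v ^+ 3.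
    by rewrite [LHS]E2 /cube_im; ring.
  by move: E3; rewrite Ew; clear; lia.
- have [w Ew] := even_mul_add u v.
  have E3 : 2 * i + 1 = 3 * (u * v * (u + v)) + 2 * v ^+ 3.
    by rewrite -Es E1 /cube_im; ring.
  by move: E3; rewrite Ew; clear; lia.
have E3 : (- (u + v)) ^+ 3 + 3 * (- (u + v)) ^+ 2 * (- v) + (- v) ^+ 3 = 1.
  apply: (@etrans _ _ (- (golden_re u v + 2 * golden_im u v))); last by rewrite -E2.
  by rewrite /cube_re /cube_im; ring.
case: (thue E3) => -[Euv Ev].
- have v0 : v = 0 by lia.
  have u1 : u = -1 by lia.
  by apply: Or32; rewrite E1 v0 u1 /cube_re /cube_im; ring.
- have v0 : v = -1 by lia.
  have u1 : u = 1 by lia.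
  by apply: Or31; rewrite E1 v0 u1 /cube_re /cube_im; ring.
- have v0 : v = -1 by lia.
  have u1 : u = 4 by lia.
  by apply: Or33; rewrite E1 v0 u1 /cube_re /cube_im; ring.
Qed.

(** Eliminating a gives 4 t^3 = s^6 - 4 s^3 - 1, which factors as 4 D F with
D = s^2 - s - 1 and 4 F = s^4 + s^3 + 2 s^2 - s + 1. As 4 F is congruent to
6 s^2 modulo D, and D is prime to 2, 3 and s, both D and F are cubes. *)
Lemma no_two_cubes_golden (a s t : int) : t != 0 ->
  2 * a - 1 = s ^+ 3 -> a ^+ 2 - 3 * a + 1 = t ^+ 3 -> a = 0 \/ a = 1.
Proof.
move=> t0 Es Et.
have [i Ei] : exists i, s = 2 * i + 1.
  have [i [Ei|Ei]] := parity s; last by exists i.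
  by move: Es; rewrite Ei; clear; lia.
pose D := s ^+ 2 - s - 1.
pose F := 4 * i ^+ 4 + 10 * i ^+ 3 + 11 * i ^+ 2 + 5 * i + 1.
have EF : 4 * F = D * (s ^+ 2 + 2 * s - 1) + 2 * 3 * s ^+ 2.
  by rewrite /F /D Ei; ring.
have EDF : D * F = t ^+ 3.
  apply: (@mulfI _ 4) => //.
  have -> : 4 * (D * F) = s ^+ 6 - 4 * s ^+ 3 - 1 by rewrite /F /D Ei; ring.
  have -> : s ^+ 6 = (s ^+ 3) ^+ 2 by ring.
  by rewrite -Es -Et; ring.
have cD2 : coprimez D 2.
  rewrite coprimez_sym; apply: (@coprimez_2 _ (2 * i ^+ 2 + i - 1)).
  by rewrite /D Ei; ring.
have cD3 : coprimez D 3.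
  rewrite coprimez_sym coprimez_3 //; apply/negP => /dvdzP[w].
  have -> : D = s * (s - 1) - 1 by rewrite /D; ring.
  have [k [Ek|[Ek|Ek]]] : exists k, s = 3 * k \/ (s = 3 * k + 1 \/ s = 3 * k + 2).
    by exists (s %/ 3)%Z; clear; lia.
  - by rewrite Ek; clear; lia.
  - by rewrite Ek; clear; lia.
  - by rewrite Ek; clear; lia.
have cDs : coprimez D s.
  rewrite coprimez_sym; have -> : D = (s - 1) * s + (- 1) by rewrite /D; ring.
  by rewrite coprimezMDl coprimezE /= coprimen1.
have cDF : coprimez D F.
  suff : coprimez D (4 * F) by rewrite coprimezMr => /andP[].
  rewrite EF [D * _]mulrC coprimezMDl coprimezMr coprimezXr // andbT.
  by rewrite coprimezMr cD2.
have [p [q [Ep Eq Epq]]] := coprime_cubes cDF t0 EDF.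
have p0 : p != 0 by apply: contraNneq t0 => p0; rewrite -Epq p0 mul0r.
case: (golden_cube Ei p0 Ep) => s1.
- by right; move: Es; rewrite s1; clear; lia.
- by left; move: Es; rewrite s1; clear; lia.
have i18 : i = 18 by move: Ei; rewrite s1; clear; lia.
move: Eq; rewrite /F i18; clear => Eq.
have [q79|q78] := leP 79 q; first by have := cube_le q79; rewrite -Eq; lia.
have {}q78 : q <= 78 by lia.
by have := cube_le q78; rewrite -Eq; lia.
Qed.

(** * The equation s^4 + 1 = 2 t^2 *)

Lemma coprime_squares (u v w : int) : coprimez u v -> 0 < u -> 0 < v ->
  u * v = w ^+ 2 -> exists r s, [/\ 0 < r, 0 < s, u = r ^+ 2 & v = s ^+ 2].
Proof.
move=> cuv u0 v0 E.
have uv0 : u * v != 0 by rewrite mulf_neq0 ?gt_eqF.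
have : zpower 2 (u * v).
  rewrite E; apply: zpower2_square; apply: contraNneq uv0 => w0.
  by rewrite E w0 expr0n.
case/(zpower_mul (e := 2) isT cuv (lt0r_neq0 u0) (lt0r_neq0 v0)).
by move=> /(zpower2_pos u0)[r r0 Er] /(zpower2_pos v0)[s s0 Es]; exists r, s.
Qed.

Lemma coprimez_sqr x y : coprimez (x ^+ 2) (y ^+ 2) = coprimez x y.
Proof. by rewrite coprimez_pexpl // coprimez_pexpr. Qed.

(** (C - A) / 2 and (C + A) / 2 are coprime with product b^2, hence squares. *)
Lemma pythagorean (A b C : int) : 0 < A -> 0 < b -> 0 < C ->
  coprimez A (2 * b) -> A ^+ 2 + (2 * b) ^+ 2 = C ^+ 2 ->
  exists m n, [/\ 0 < m, 0 < n, coprimez m n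
     & [/\ A = m ^+ 2 - n ^+ 2, b = m * n & C = m ^+ 2 + n ^+ 2]].
Proof.
move=> A0 b0 C0 cAb E.
have [f Ef] : exists f, C = A + 2 * f.
  have [i [Ei|Ei]] := parity A.
    by move: cAb; rewrite Ei coprimezMl coprimezMr.
  have [j [Ej|Ej]] := parity C.
    by move: E; rewrite Ei Ej; clear; lia.
  by exists (j - i); rewrite Ei Ej; ring.
have Efb : f * (A + f) = b ^+ 2.
  by apply: (@mulfI _ 4) => //; move: E; rewrite Ef; clear; lia.
have f0 : 0 < f by move: Efb A0 b0 C0; rewrite Ef; clear; nia.
have cf : coprimez f (A + f).
  have -> : A + f = 1 * f + A by ring.
  rewrite coprimezMDl coprimez_sym.
  have : coprimez A (b ^+ 2) by rewrite coprimezXr //; move: cAb; rewrite coprimezMr => /andP[].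
  by rewrite -Efb coprimezMr => /andP[].
have Af0 : 0 < A + f by rewrite addr_gt0.
have [n [m [n0 m0 En Em]]] := coprime_squares cf f0 Af0 Efb.
have cmn : coprimez m n by rewrite coprimez_sym -coprimez_sqr -En -Em.
exists m, n; split=> //; split.
- by rewrite -En -Em; ring.
- have : b ^+ 2 = (m * n) ^+ 2 by rewrite exprMn -En -Em -Efb mulrC.
  by move/eqP; rewrite eqrXn2 ?ltW ?mulr_gt0 // => /eqP.
- by rewrite -En -Em Ef; ring.
Qed.

(** The pairwise coprime numbers m, n, m - n, m + n have a square product, hence
they are squares p^2, q^2, w^2, r^2. Then (r + w) / 2 and (r - w) / 2 are the
legs of a right triangle with hypotenuse p, and their product n / 2 is twice a
square; the even leg is written 2 b. *)
Lemma congruum_step (m n K : int) : 0 < m -> 0 < n -> 0 < m ^+ 2 - n ^+ 2 ->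
  coprimez m n -> (exists i, m + n = 2 * i + 1) ->
  (m ^+ 2 - n ^+ 2) * (m * n) = K ^+ 2 ->
  exists p a b l, [/\ 0 < p, 0 < a, 0 < b & 0 < l] /\
    [/\ coprimez a (2 * b), a ^+ 2 + (2 * b) ^+ 2 = p ^+ 2, a * (2 * b) = 2 * l ^+ 2
      & m = p ^+ 2].
Proof.
move=> m0 n0 mn0 cmn [i Ei] E.
have ltnm : 0 < m - n by move: mn0 m0 n0; clear; nia.
have mpn0 : 0 < m + n by rewrite addr_gt0.
have c1 : coprimez (m * n) ((m - n) * (m + n)).
  rewrite coprimezMl !coprimezMr.
  have -> : coprimez m (m - n).
    have -> : m - n = 1 * m + (- n) by ring.
    by rewrite coprimezMDl coprimezN.
  have -> : coprimez m (m + n).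
    have -> : m + n = 1 * m + n by ring.
    by rewrite coprimezMDl.
  have -> : coprimez n (m - n).
    have -> : m - n = (- 1) * n + m by ring.
    by rewrite coprimezMDl coprimez_sym.
  have -> : m + n = 1 * n + m by ring.
  by rewrite coprimezMDl coprimez_sym.
have c2 : coprimez (m - n) (m + n).
  have -> : m + n = 1 * (m - n) + 2 * n by ring.
  rewrite coprimezMDl coprimezMr; apply/andP; split.
    rewrite coprimez_sym; apply: (@coprimez_2 _ (i - n)).
    have -> : m - n = m + n - 2 * n by ring.
    by rewrite Ei; ring.
  rewrite coprimez_sym; have -> : m - n = (- 1) * n + m by ring.
  by rewrite coprimezMDl coprimez_sym.
have [|M [M' [M0 M'0 EM EM']]] := @coprime_squares _ _ K c1 (mulr_gt0 m0 n0) (mulr_gt0 ltnm mpn0).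
  by rewrite -E; ring.
have [p [q [p0 q0 Ep Eq]]] := coprime_squares cmn m0 n0 EM.
have [w [r [w0 r0 Ew Er]]] := coprime_squares c2 ltnm mpn0 EM'.
have [ri Eri] : exists j, r = 2 * j + 1.
  have [j [Ej|Ej]] := parity r; last by exists j.
  by move: Er; rewrite Ei Ej; clear; lia.
have [wi Ewi] : exists j, w = 2 * j + 1.
  have [j [Ej|Ej]] := parity w; last by exists j.
  have Em : m - n = 2 * (i - n) + 1.
    have -> : m - n = m + n - 2 * n by ring.
    by rewrite Ei; ring.
  by move: Ew; rewrite Em Ej; clear; lia.
pose a := ri + wi + 1; pose b := ri - wi.
have crw : coprimez r w by rewrite coprimez_sym -coprimez_sqr -Ew -Er.
have Eab : a + b = r /\ a - b = w by rewrite /a /b Eri Ewi; split; ring.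
have Eab2 : 2 * (a * b) = n.
  have : 2 * (2 * (a * b)) = 2 * n.
    have -> : 2 * (2 * (a * b)) = r ^+ 2 - w ^+ 2.
      by case: Eab => <- <-; ring.
    by rewrite -Ew -Er; ring.
  by move=> H; apply: (@mulfI _ 2).
have Esq : a ^+ 2 + b ^+ 2 = m.
  have : 2 * (a ^+ 2 + b ^+ 2) = 2 * m.
    have -> : 2 * (a ^+ 2 + b ^+ 2) = r ^+ 2 + w ^+ 2.
      by case: Eab => <- <-; ring.
    by rewrite -Ew -Er; ring.
  by move=> H; apply: (@mulfI _ 2).
have cab : coprimez a b.
  have /coprimezP[[x y] /= Exy] : coprimez (a + b) (a - b).
    by case: Eab => -> ->.
  by apply/coprimezP; exists (x + y, x - y); rewrite /= -Exy; ring.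
have a0 : 0 < a by move: w0 r0; rewrite /a Eri Ewi; clear; lia.
have b0 : 0 < b by move: a0 n0; rewrite -Eab2; clear; nia.
have [l El] : exists l, q = 2 * l.
  have [l [El|El]] := parity q; first by exists l.
  by move: Eq; rewrite -Eab2 El; clear; lia.
have l0 : 0 < l by move: q0; rewrite El; clear; lia.
have Eabl : a * b = 2 * l ^+ 2.
  by apply: (@mulfI _ 2) => //; rewrite Eab2 Eq El; ring.
have [c [Ec|Ec]] := parity b.
  exists p, a, c, l; rewrite -Ec Esq Ep; do 2!split=> //.
  by move: b0; rewrite Ec; clear; lia.
have [d [Ed|Ed]] := parity a.
  exists p, b, d, l; rewrite -Ed addrC Esq Ep [b * a]mulrC coprimez_sym.
  do 2!split=> //.
  by move: a0; rewrite Ed; clear; lia.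
by case: Eab => Er2 _; move: Er2; rewrite Ec Ed Eri; clear; lia.
Qed.

(** Fermat's descent on the hypotenuse: the area A b is (m^2 - n^2) m n for the
parameters of the triangle, and [congruum_step] yields a triangle of square area
whose hypotenuse p satisfies p^2 = m. *)
Lemma no_right_triangle_of_square_area (A b C K : int) :
  0 < A -> 0 < b -> 0 < C -> coprimez A (2 * b) ->
  A ^+ 2 + (2 * b) ^+ 2 = C ^+ 2 -> A * (2 * b) <> 2 * K ^+ 2.
Proof.
have [k] := ubnP `|C|%N; elim: k A b C K => // k IH A b C K ltk A0 b0 C0 cAb E EK.
have [m [n [m0 n0 cmn [EA Eb EC]]]] := pythagorean A0 b0 C0 cAb E.
have odd_mn : exists i, m + n = 2 * i + 1.
  have [i [Ei|Ei]] := parity (m + n); last by exists i.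
  move: cAb; have -> : A = 2 * (i * (m - n)).
    have -> : 2 * (i * (m - n)) = 2 * i * (m - n) by ring.
    by rewrite -Ei EA; ring.
  by rewrite coprimezMl coprimezMr.
have [||p [a [b' [l [[p0 a0 b'0 l0] [cab Eab El Em]]]]]] :=
    @congruum_step m n K m0 n0 _ cmn odd_mn.
- by rewrite -EA.
- by apply: (@mulfI _ 2) => //; rewrite -EK EA Eb; ring.
apply: (IH a b' p l) El => //.
apply: (@leq_trans `|C|%N); last by rewrite -ltnS.
by move: EC m0 n0 p0 C0; rewrite Em; clear; nia.
Qed.

(** The equation says t^4 - s^4 = (t^2 - 1)^2. The right triangle with legs (t s)^2
and (t^4 - s^4) / 2 and hypotenuse (t^4 + s^4) / 2 has square area. With
t^2 = 2y + 1 and s^4 = 4y + 1 the second leg is 2 y^2. *)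
Lemma quartic_twice_square (s t : int) : s ^+ 4 + 1 = 2 * t ^+ 2 -> s ^+ 2 = 1.
Proof.
move=> E.
have [i Ei] : exists i, s = 2 * i + 1.
  have [i [Ei|Ei]] := parity s; last by exists i.
  by move: E; rewrite Ei; clear; lia.
have [j Ej] : exists j, t = 2 * j + 1.
  have [j [Ej|Ej]] := parity t; last by exists j.
  by move: E; rewrite Ei Ej; clear; lia.
pose y := 2 * j ^+ 2 + 2 * j.
have Ey : t ^+ 2 = 2 * y + 1 by rewrite Ej /y; ring.
have Ey4 : s ^+ 4 = 4 * y + 1.
  by apply: (@addIr _ 1); rewrite E Ey; ring.
have y_ge0 : 0 <= y by rewrite /y; clear; nia.
have [y0|y_neq0] := eqVneq y 0.
  have : (s ^+ 2) ^+ 2 = 1 by rewrite -exprM Ey4 y0.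
  by have := sqr_ge0 s; move: (s ^+ 2) => r; clear; nia.
have y_gt0 : 0 < y by rewrite lt_neqAle eq_sym y_neq0.
have s0 : s != 0 by apply/eqP => s0; move: Ei; rewrite s0; clear; lia.
have t0 : t != 0 by apply/eqP => t0; move: Ej; rewrite t0; clear; lia.
have cyt : coprimez t (2 * y).
  have -> : 2 * y = t * t + (- 1) by rewrite -expr2 Ey; ring.
  by rewrite coprimezMDl coprimezE /= coprimen1.
have cys : coprimez s (2 * (2 * y)).
  have -> : 2 * (2 * y) = s ^+ 3 * s + (- 1) by rewrite -exprSr Ey4; ring.
  by rewrite coprimezMDl coprimezE /= coprimen1.
have cy : coprimez ((t * s) ^+ 2) (2 * y ^+ 2).
  rewrite !coprimezMr in cyt cys; have [t2 ty] := andP cyt.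
  have [s2 _ sy] := and3P cys.
  apply: coprimezXl; rewrite coprimezMl; apply/andP; split.
    by rewrite coprimezMr t2 coprimezXr.
  by rewrite coprimezMr s2 coprimezXr.
apply: False_ind.
apply: (@no_right_triangle_of_square_area ((t * s) ^+ 2) (y ^+ 2)
          (s ^+ 4 + 2 * y ^+ 2) (y * t * s)) => //.
- by rewrite lt_neqAle sqr_ge0 eq_sym sqrf_eq0 mulf_neq0.
- by rewrite exprn_gt0.
- by rewrite Ey4; move: y_gt0; clear; nia.
- have -> : ((t * s) ^+ 2) ^+ 2 = (t ^+ 2) ^+ 2 * s ^+ 4 by ring.
  by rewrite Ey Ey4; ring.
- by ring.
Qed.

(** * Polynomials in a that are not simultaneously powers *)

(** The absolute values of a and a - 1 are consecutive positive integers, but e-th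
powers of distinct positive integers differ by more than 1. *)
Lemma consecutive_powers e (a : int) : (1 < e)%N ->
  zpower e a -> zpower e (a - 1) -> False.
Proof.
move=> e1 [a0 [k Ek]] [a1 [l El]].
have key x y : (0 < y)%N -> (x ^ e = y ^ e + 1)%N -> False.
  move=> y0 E; have ltyx : (y < x)%N.
    by rewrite -(@ltn_exp2r _ _ e) ?(ltnW e1) // E addn1.
  have lexe : (y.+1 ^ e <= x ^ e)%N by rewrite leq_exp2r // ltnW.
  case: e e1 {Ek El} E lexe => [|[|e]] // _ -> {x ltyx}; rewrite leqNgt => /negP; apply.
  have : (y ^ e.+1 < y.+1 ^ e.+1)%N by rewrite ltn_exp2r.
  rewrite (expnS y.+1 e.+1) (expnS y e.+1); move: (y ^ _)%N (y.+1 ^ _)%N => u v.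
  by move: y0; clear; nia.
have k0 : (0 < k)%N by case: k Ek => // Ek; move: a0; rewrite -absz_eq0 Ek exp0n ?(ltnW e1).
have l0 : (0 < l)%N by case: l El => // El; move: a1; rewrite -absz_eq0 El exp0n ?(ltnW e1).
have [a_pos|a_neg] := leP 1 a.
  by apply: (key k l l0); rewrite -Ek -El; lia.
by apply: (key l k k0); rewrite -Ek -El; lia.
Qed.

(** Strictly between (a - 1)^2 and a^2 for a > 1, and between a^2 and (a - 1)^2 for
a < 0. *)
Lemma quadratic_not_square (a : int) : a != 0 -> a != 1 -> ~ zpower 2 (a ^+ 2 - a + 1).
Proof.
move=> a0 a1 /zpower2_pos[|r r0 Er]; first by nia.
have [a2|a2] := leP 2 a.
  have [ra|ra] := leP a r; first by move: Er; nia.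
  by move: Er; nia.
have [ra|ra] := leP (1 - a) r; first by move: Er; nia.
by move: Er; nia.
Qed.

(** For a = r^3 the second value r^6 - 3 r^3 + 1 lies strictly between the cubes of
r^2 - 1 and r^2 if r > 1, and between those of r^2 and r^2 + 1 if r < 0. *)
Lemma no_two_cubes_quadratic (a : int) : a != 0 -> a != 1 ->
  zpower 3 a -> zpower 3 (a ^+ 2 - 3 * a + 1) -> False.
Proof.
move=> a0 a1 /zpower3P[r r0 Er] /zpower3P[t t0 Et].
have E : (r ^+ 2) ^+ 3 - 3 * r ^+ 3 + 1 = t ^+ 3.
  by rewrite -Et Er; ring.
have r1 : r != 1 by apply: contraNneq a1 => r1; rewrite Er r1 expr1n.
have [r_pos|r_neg] := leP 2 r.
  have [rt|rt] := leP (r ^+ 2) t.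
    by have := cube_le rt; rewrite -E; move: r_pos; clear; nia.
  have rt2 : t <= r ^+ 2 - 1 by lia.
  have := cube_le rt2; rewrite -E; move: r_pos; clear; nia.
have r_neg' : r <= -1 by lia.
have [rt|rt] := leP (r ^+ 2 + 1) t.
  by have := cube_le rt; rewrite -E; move: r_neg'; clear; nia.
have rt2 : t <= r ^+ 2 by lia.
have := cube_le rt2; rewrite -E; move: r_neg'; clear; nia.
Qed.

(** The case e = 1 serves for a = r^3 and the case e = -1 for a - 1 = r^3. *)
Lemma sum_with_sign_cubes (s r a e : int) : (e = 1 \/ e = -1) ->
  s ^+ 3 + e ^+ 3 = 2 * r ^+ 3 -> 2 * a - 1 = s ^+ 3 -> a = 0 \/ a = 1.
Proof.
move=> e1 E Es.
have ce : coprimez s e by case: e1 => ->; rewrite coprimezE /= coprimen1.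
have /eqP := sum_of_cubes_twice_cube ce E.
rewrite eqf_sqr; case: e1 => -> /orP[] /eqP s1; move: Es; rewrite s1; clear; lia.
Qed.

Lemma no_cubes_a_2a1 (a : int) : a != 0 -> a != 1 ->
  zpower 3 a -> zpower 3 (2 * a - 1) -> False.
Proof.
move=> a0 a1 /zpower3P[r _ Er] /zpower3P[s _ Es].
have E : s ^+ 3 + 1 ^+ 3 = 2 * r ^+ 3 by rewrite -Es -Er; ring.
by case: (sum_with_sign_cubes (or_introl erefl) E Es) => /eqP; rewrite ?(negPf a0) ?(negPf a1).
Qed.

Lemma no_cubes_a1_2a1 (a : int) : a != 0 -> a != 1 ->
  zpower 3 (a - 1) -> zpower 3 (2 * a - 1) -> False.
Proof.
move=> a0 a1 /zpower3P[r _ Er] /zpower3P[s _ Es].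
have E : s ^+ 3 + (-1) ^+ 3 = 2 * r ^+ 3 by rewrite -Es -Er; ring.
by case: (sum_with_sign_cubes (or_intror erefl) E Es) => /eqP; rewrite ?(negPf a0) ?(negPf a1).
Qed.

Lemma sum_consecutive_squares_not_cube (a : int) : a != 0 -> a != 1 ->
  ~ zpower 3 (2 * a ^+ 2 - 2 * a + 1).
Proof.
move=> a0 a1 /zpower3P[t t0 Et].
have E : a ^+ 2 + (a - 1) ^+ 2 = t ^+ 3 by rewrite -Et; ring.
by have /eqP := gaussian_cube t0 E; rewrite mulf_eq0 (negPf a0) subr_eq0 (negPf a1).
Qed.

(** 2 (2a^2 - 2a + 1) = (2a - 1)^2 + 1, and 2a - 1 is a square up to sign. *)
Lemma no_squares_2a1_sum (a : int) : a != 0 -> a != 1 ->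
  zpower 2 (2 * a - 1) -> zpower 2 (2 * a ^+ 2 - 2 * a + 1) -> False.
Proof.
move=> a0 a1 /is_squareE[s [_ Es]] /zpower2_pos[|t _ Et]; first by nia.
have : s ^+ 4 + 1 = 2 * t ^+ 2.
  rewrite -Et; have -> : s ^+ 4 = (2 * a - 1) ^+ 2 by case: Es => ->; ring.
  by ring.
move/quartic_twice_square => s1; rewrite s1 in Es.
by case: Es => Es; [case/eqP: a1|case/eqP: a0]; move: Es; clear; lia.
Qed.

Lemma no_cubes_2a1_golden (a : int) : a != 0 -> a != 1 ->
  zpower 3 (2 * a - 1) -> zpower 3 (a ^+ 2 - 3 * a + 1) -> False.
Proof.
move=> a0 a1 /zpower3P[s _ Es] /zpower3P[t t0 Et].
by case: (no_two_cubes_golden t0 Es Et) => /eqP; rewrite ?(negPf a0) ?(negPf a1).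
Qed.

(** * The sequence of division polynomials at the origin *)

(** The recurrences of the division polynomials (an elliptic divisibility sequence),
the even one in the form without division by u_2. *)
Definition eds (u : nat -> int) : Prop :=
  (forall n : nat, (2 <= n)%N ->
     u (2 * n + 1)%N = u (n + 2)%N * u n ^+ 3 - u (n - 1)%N * u (n + 1)%N ^+ 3)
  /\ (forall n : nat, (3 <= n)%N ->
     u (2 * n)%N * u 2%N
     = u (n - 1)%N ^+ 2 * u n * u (n + 2)%N
       - u (n - 2)%N * u n * u (n + 1)%N ^+ 2).

(** The recurrences start at index 5, and u_2 can be cancelled. *)
Lemma eds_unique u v : eds u -> eds v ->
  (forall n, (n < 5)%N -> u n = v n) -> v 2%N != 0 -> u =1 v.
Proof.
move=> [uo ue] [vo ve] init v2 n; elim/ltn_ind: n => n IH.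
case: (ltnP n 5) => [|n5]; first exact: init.
have [on|en] := boolP (odd n).
  have -> : (n = 2 * n./2 + 1)%N by lia.
  by rewrite uo ?vo ?IH //; lia.
apply: (mulIf v2); have -> : (n = 2 * n./2)%N by lia.
by rewrite -{1}(init 2%N) // ue ?ve ?IH //; lia.
Qed.

(** A shift of n by N multiplies all terms of a recurrence by the same factor,
w1^(4n+2) w0^4 in the first and w1^(4n) w0^4 in the second: on the right four
values are shifted by N and their indices add up to 4n + 2, respectively 4n; on
the left one value is shifted by 2N, which has the same effect because
w1^N = w0^2. *)
Lemma eds_of_quasiperiod (v : nat -> int) (N : nat) (w1 w0 : int) :
  (0 < N)%N -> (forall n, v (n + N)%N = v n * w1 ^+ n * w0) ->
  w1 ^+ N = w0 ^+ 2 ->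
  (forall n, (2 <= n < 2 + N)%N ->
     v (2 * n + 1)%N = v (n + 2)%N * v n ^+ 3 - v (n - 1)%N * v (n + 1)%N ^+ 3) ->
  (forall n, (3 <= n < 3 + N)%N ->
     v (2 * n)%N * v 2%N
     = v (n - 1)%N ^+ 2 * v n * v (n + 2)%N
       - v (n - 2)%N * v n * v (n + 1)%N ^+ 2) ->
  eds v.
Proof.
move=> N0 per w01 vo ve.
have per2 m : v (m + 2 * N)%N = v m * (w1 ^+ m) ^+ 2 * w0 ^+ 4.
  rewrite mul2n -addnn addnA !per exprD w01; ring.
split=> n; elim/ltn_ind: n => n IH n2.
  have [lt_n|le_n] := ltnP n (2 + N); first by apply: vo; rewrite n2.
  have [m Em m2] : exists2 m, n = (m + N)%N & (2 <= m)%N.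
    by exists (n - N)%N; lia.
  have lt_m : (m < n)%N by lia.
  have {}IH := IH m lt_m m2; rewrite Em.
  have -> : (2 * (m + N) + 1 = 2 * m + 1 + 2 * N)%N by lia.
  have -> : (m + N + 2 = m + 2 + N)%N by lia.
  have -> : (m + N + 1 = m + 1 + N)%N by lia.
  have -> : (m + N - 1 = m - 1 + N)%N by lia.
  rewrite per2 IH !per.
  have [k Ek] : exists k, m = (k + 1)%N by exists (m - 1)%N; lia.
  have -> : (2 * m + 1 = k + k + 3)%N by lia.
  have -> : (m - 1 = k)%N by lia.
  by rewrite Ek !exprD; ring.
have [lt_n|le_n] := ltnP n (3 + N); first by apply: ve; rewrite n2.
have [m Em m2] : exists2 m, n = (m + N)%N & (3 <= m)%N.
  by exists (n - N)%N; lia.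
have lt_m : (m < n)%N by lia.
have {}IH := IH m lt_m m2; rewrite Em.
have -> : (2 * (m + N) = 2 * m + 2 * N)%N by lia.
have -> : (m + N + 2 = m + 2 + N)%N by lia.
have -> : (m + N + 1 = m + 1 + N)%N by lia.
have -> : (m + N - 1 = m - 1 + N)%N by lia.
have -> : (m + N - 2 = m - 2 + N)%N by lia.
rewrite per2.
have -> : v (2 * m)%N * (w1 ^+ (2 * m)) ^+ 2 * w0 ^+ 4 * v 2%N
  = (v (2 * m)%N * v 2%N) * (w1 ^+ (2 * m)) ^+ 2 * w0 ^+ 4 by ring.
rewrite IH !per.
have [k ->] : exists k, m = (k + 2)%N by exists (m - 2)%N; lia.
have -> : (k + 2 - 1 = k + 1)%N by lia.
have -> : (k + 2 - 2 = k)%N by lia.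
have -> : (2 * (k + 2) = k + k + 4)%N by lia.
rewrite !exprD; ring.
Qed.

Lemma eval_xyD p q x y : eval_xy (p + q) x y = eval_xy p x y + eval_xy q x y.
Proof. by rewrite /eval_xy !hornerD. Qed.

Lemma eval_xyN p x y : eval_xy (- p) x y = - eval_xy p x y.
Proof. by rewrite /eval_xy !hornerN. Qed.

Lemma eval_xyM p q x y : eval_xy (p * q) x y = eval_xy p x y * eval_xy q x y.
Proof. by rewrite /eval_xy !hornerM. Qed.

Lemma eval_xyXn p k x y : eval_xy (p ^+ k) x y = eval_xy p x y ^+ k.
Proof. by rewrite /eval_xy !horner_exp. Qed.

Lemma eval_xyn k x y : eval_xy k%:R x y = k%:R.
Proof. by rewrite /eval_xy -polyC_natr hornerC -polyC_natr hornerC. Qed.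

Lemma eval_xyC c x y : eval_xy c%:P%:P x y = c.
Proof. by rewrite /eval_xy !hornerC. Qed.

Lemma eval_xyX x y : eval_xy 'X%:P x y = x.
Proof. by rewrite /eval_xy hornerC hornerX. Qed.

Lemma eval_xyY x y : eval_xy 'X x y = y.
Proof. by rewrite /eval_xy hornerX hornerC. Qed.

Definition eval_xyE :=
  (eval_xyD, eval_xyN, eval_xyXn, eval_xyM, eval_xyn, eval_xyC, eval_xyX, eval_xyY).

Definition psi_at0 (W : weierstrass) (n : nat) : int := eval_xy (psi W n) 0 0.

Lemma eds_psi_at0 W : eds (psi_at0 W).
Proof.
have [p0 [p1 p2 p3 p4] po pe] := psiP W; split=> n n2; rewrite /psi_at0.
  by rewrite po // !eval_xyE.
by rewrite p2 -eval_xyM pe // !eval_xyE.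
Qed.

Lemma psi_at0_init W : w_a4 W = 0 -> w_a6 W = 0 ->
  [/\ psi_at0 W 0 = 0, psi_at0 W 1 = 1, psi_at0 W 2 = w_a3 W,
      psi_at0 W 3 = w_a2 W * w_a3 W ^+ 2
    & psi_at0 W 4 = w_a3 W ^+ 4 * (w_a1 W * w_a2 W - w_a3 W)].
Proof.
move=> a4 a6; have [p0 [p1 p2 p3 p4] po pe] := psiP W.
rewrite /psi_at0 p0 p1 p2 p3 p4 /psi4 /psi3 /psi2 !eval_xyE.
rewrite /w_b8 /w_b6 /w_b4 /w_b2 a4 a6.
by split=> //; ring.
Qed.

(** The x-coordinate of P is 0. *)
Lemma G_psi W n : (0 < n)%N -> G W n = - (psi_at0 W n.+1 * psi_at0 W n.-1).
Proof.
have [p0 [p1 p2 p3 p4] po pe] := psiP W.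
case: n => [|[|n]] // _; rewrite /G /psi_at0 /phi.
  by rewrite p0 eval_xyX (eval_xyn 0) mulr0 oppr0.
by rewrite addn1 subn1 !eval_xyE mul0r add0r.
Qed.

(** * Certified factorizations *)

(** Polynomials as lists of coefficients, constant term first, so that identities
between them can be decided by computation. *)
Fixpoint peval (a : int) (p : seq int) : int :=
  if p is c :: p' then c + a * peval a p' else 0.

Fixpoint padd (p q : seq int) : seq int :=
  match p, q with
  | c :: p', d :: q' => (c + d) :: padd p' q'
  | [::], _ => q
  | _, [::] => p
  end.
Definition pscale (c : int) (p : seq int) : seq int := [seq c * d | d <- p].
Fixpoint pmul (p q : seq int) : seq int :=
  if p is c :: p' then padd (pscale c q) (0 :: pmul p' q) else [::].
Definition pexp (p : seq int) (k : nat) : seq int := iter k (pmul p) [:: 1].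

Lemma peval_add a p q : peval a (padd p q) = peval a p + peval a q.
Proof.
elim: p q => [|c p IH] [|d q]; rewrite /= ?add0r ?addr0 // IH; ring.
Qed.

Lemma peval_scale a c p : peval a (pscale c p) = c * peval a p.
Proof. by elim: p => [|d p IH]; rewrite /= ?mulr0 // IH; ring. Qed.

Lemma peval_mul a p q : peval a (pmul p q) = peval a p * peval a q.
Proof.
elim: p => [|c p IH]; first by rewrite mul0r.
by rewrite [LHS]peval_add peval_scale /= IH; ring.
Qed.

Lemma peval_exp a p k : peval a (pexp p k) = peval a p ^+ k.
Proof.
elim: k => [|k IH]; first by rewrite /= mulr0 addr0.
by rewrite /pexp iterS peval_mul -/(pexp p k) IH exprS.
Qed.

Lemma peval_zero a p : all (fun c => c == 0) p -> peval a p = 0.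
Proof. by elim: p => //= c p IH /andP[/eqP-> /IH->]; rewrite mulr0 addr0. Qed.

(** A monomial c f_0^(e_0) f_1^(e_1) ... in the factors f_i. Exponents are kept as
numbers: they grow quadratically with n, and expanding the powers would be too
expensive. *)
Definition mono : Type := (int * (nat -> nat))%type.
Definition mmul (m m' : mono) : mono := (m.1 * m'.1, fun i => (m.2 i + m'.2 i)%N).
Definition mexp (m : mono) (k : nat) : mono := (m.1 ^+ k, fun i => (k * m.2 i)%N).
Definition mval (fs : seq int) (m : mono) : int :=
  m.1 * \prod_(i < size fs) fs`_i ^+ m.2 i.

Definition zero_mono : mono := (0, fun=> 0%N).
Definition mono_of (c : int) (es : seq nat) : mono := (c, nth 0%N es).

Lemma mval_mul fs m m' : mval fs (mmul m m') = mval fs m * mval fs m'.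
Proof.
rewrite /mval /= mulrACA -big_split; congr (_ * _).
by apply: eq_bigr => i _; rewrite exprD.
Qed.

Lemma mval_exp fs m k : mval fs (mexp m k) = mval fs m ^+ k.
Proof.
rewrite /mval /= exprMn -prodrXl; congr (_ * _).
by apply: eq_bigr => i _; rewrite -exprM mulnC.
Qed.

Lemma eq_mval fs m m' : m.1 = m'.1 -> m.2 =1 m'.2 -> mval fs m = mval fs m'.
Proof.
by move=> E1 E2; rewrite /mval E1; congr (_ * _); apply: eq_bigr => i _; rewrite E2.
Qed.

Section Certificate.
Variable ps : seq (seq int).

(** The quotient of m by the monomial with exponents e, expanded. *)
Definition cofactor (e : nat -> nat) (m : mono) : seq int :=
  if m.1 == 0 then [::] else
  pscale m.1 (foldr (fun i p => pmul (pexp (nth [::] ps i) (m.2 i - e i)) p)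
                    [:: 1] (iota 0 (size ps))).

(** The exponents of the greatest common monomial. Zero terms are left out, because
their exponents are meaningless and would destroy the cancellation. *)
Definition common (ms : seq mono) (i : nat) : nat :=
  let es := [seq m.2 i | m : mono <- ms & m.1 != 0] in
  foldr minn (head 0%N es) es.

(** Decides x = y - z by dividing by the common monomial first: what is left to
compare are polynomials of small degree. *)
Definition sub_certificate (x y z : mono) : bool :=
  let e := common [:: x; y; z] in
  all (fun c => c == 0)
    (padd (cofactor e x) (padd (pscale (-1) (cofactor e y)) (cofactor e z))).

Variable a : int.
Let fs := [seq peval a p | p <- ps].

Lemma cofactorP e (m : mono) : (m.1 != 0 -> forall i, (e i <= m.2 i)%N) ->
  mval fs m = peval a (cofactor e m) * \prod_(i < size fs) fs`_i ^+ e i.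
Proof.
rewrite /mval /cofactor => le_e; have [m0|m0] := altP (m.1 =P 0).
  by rewrite m0 /= !mul0r.
rewrite peval_scale -mulrA; congr (_ * _).
have -> (s : seq nat) :
    peval a (foldr (fun i p => pmul (pexp (nth [::] ps i) (m.2 i - e i)) p)
       [:: 1] s) = \prod_(i <- s) peval a (nth [::] ps i) ^+ (m.2 i - e i).
  elim: s => [|i s IH]; first by rewrite big_nil /= mulr0 addr0.
  by rewrite big_cons -IH -peval_exp -peval_mul.
have -> : size fs = size ps by rewrite size_map.
have -> : iota 0 (size ps) = index_iota 0 (size ps) by rewrite /index_iota subn0.
rewrite big_mkord -big_split.
apply: eq_bigr => i _ /=; rewrite (nth_map [::]) // -exprD subnK //.
exact: le_e.
Qed.

Lemma foldr_minn_le h s k : k \in s -> (foldr minn h s <= k)%N.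
Proof.
elim: s => //= l s IH; rewrite inE => /predU1P[->|/IH]; first exact: geq_minl.
by apply: leq_trans; exact: geq_minr.
Qed.

Lemma sub_certificateP x y z :
  sub_certificate x y z -> mval fs x = mval fs y - mval fs z.
Proof.
move/(peval_zero a); rewrite !peval_add peval_scale; set e := common _ => E.
rewrite !(@cofactorP e); first last.
- by move=> x0 i; apply: foldr_minn_le; rewrite /= x0 inE eqxx.
- move=> y0 i; apply: foldr_minn_le; rewrite /= y0.
  by case: ifP; rewrite /= !inE eqxx ?orbT.
- move=> z0 i; apply: foldr_minn_le; rewrite /= z0.
  by do 2![case: ifP => _]; rewrite /= !inE eqxx ?orbT.
rewrite -mulrBl; congr (_ * _); apply/eqP; rewrite -subr_eq0 -E; apply/eqP; ring.
Qed.
End Certificate.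

(** The explicit form of psi_n(P) for one curve: the factors f_i as polynomials in
the parameter, the order N of P, the monomials psi_0(P), ..., psi_(N-1)(P), and
the quasi-periods with psi_(n+N) = psi_n w1^n w0. *)
Record torsion_data := TorsionData {
  td_factors : seq (seq int);
  td_order : nat;
  td_base : seq mono;
  td_w1 : mono;
  td_w0 : mono }.

Section Torsion.
Variable D : torsion_data.
Notation N := (td_order D).
Notation w1 := (td_w1 D).
Notation w0 := (td_w0 D).
Notation k := (size (td_factors D)).

(** The solution of the quasi-periodicity: for n = q N + r the exponents of w1 add up
to r + (r + N) + ... + (r + (q-1) N) = q r + N q (q-1) / 2. *)
Definition td_term (n : nat) : mono :=
  let q := (n %/ N)%N in let r := (n %% N)%N in
  mmul (nth zero_mono (td_base D) r)
       (mmul (mexp w1 (q * r + N * 'C(q, 2))) (mexp w0 q)).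

Definition is_sign (c : int) : bool := (c == 1) || (c == -1).

(** All that [eds_of_quasiperiod] asks for, as one computation; moreover the
coefficients are 0 or signs, and signs do not matter for being a power. *)
Definition td_valid : bool :=
  [&& (2 < N)%N,
      (w1.1 ^+ N == w0.1 ^+ 2)
        && all (fun i => N * w1.2 i == 2 * w0.2 i)%N (iota 0 k),
      all (fun n => sub_certificate (td_factors D) (td_term (2 * n + 1))
             (mmul (td_term (n + 2)) (mexp (td_term n) 3))
             (mmul (td_term (n - 1)) (mexp (td_term (n + 1)) 3))) (iota 2 N),
      all (fun n => sub_certificate (td_factors D)
             (mmul (td_term (2 * n)) (td_term 2))
             (mmul (mmul (mexp (td_term (n - 1)) 2) (td_term n)) (td_term (n + 2)))
             (mmul (mmul (td_term (n - 2)) (td_term n)) (mexp (td_term (n + 1)) 2)))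
          (iota 3 N)
    & [&& is_sign w1.1, is_sign w0.1
        & all (fun m : mono => (m.1 == 0) || is_sign m.1) (td_base D)]].

(** The formula G_n = - psi_(n+1) psi_(n-1) is right for n > 0 only. *)
Definition G_term (n : nat) : mono :=
  mmul (-1, fun=> 0%N) (mmul (td_term n.+1) (td_term n.-1)).

(** Marks the factors whose exponent in G_r is not divisible by e; [None] means that
G_r = 0. *)
Definition power_class (e r : nat) : option (seq bool) :=
  if (G_term r).1 == 0 then None
  else Some [seq ~~ (e %| (G_term r).2 i)%N | i <- iota 0 k].

Lemma power_class_residue e M : (0 < M)%N ->
  (forall n, (0 < n)%N -> power_class e (n + M) = power_class e n) ->
  forall n, (0 < n)%N ->
  power_class e n = power_class e (if n %% M == 0 then M else n %% M)%N.
Proof.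
move=> M0 shift n; elim/ltn_ind: n => n IH n0.
have [lt_Mn|le_nM] := ltnP M n.
  rewrite -{1}(subnK (ltnW lt_Mn)) shift ?subn_gt0 // IH; try lia.
  by rewrite -[in RHS](subnK (ltnW lt_Mn)) modnDr.
have [<-|neq] := eqVneq n M; first by rewrite modnn.
rewrite modn_small; last by rewrite ltn_neqAle neq.
by rewrite -(negbK (n == 0)%N) -lt0n n0.
Qed.

Hypothesis valid : td_valid.

Lemma td_term_shift n :
  (td_term (n + N)).1 = (td_term n).1 * w1.1 ^+ n * w0.1
  /\ forall i, (td_term (n + N)).2 i = ((td_term n).2 i + n * w1.2 i + w0.2 i)%N.
Proof.
have N0 : (0 < N)%N by case/andP: valid => /ltnW/ltnW.
rewrite /td_term modnDr divnDr // divnn N0 addn1.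
set q := (n %/ N)%N; set r := (n %% N)%N.
have En : (q.+1 * r + N * 'C(q.+1, 2) = q * r + N * 'C(q, 2) + n)%N.
  by rewrite binS bin1 mulnDr (divn_eq n N) -/q -/r; ring.
split=> [|i] /=; rewrite En; first by rewrite exprD exprS; ring.
by ring.
Qed.

Lemma G_term_shift n : (0 < n)%N ->
  ((G_term (n + N)).1 == 0) = ((G_term n).1 == 0) /\
  forall i, (G_term (n + N)).2 i
            = ((G_term n).2 i + 2 * (n * w1.2 i + w0.2 i))%N.
Proof.
move=> n0; have [w1s w0s] : is_sign w1.1 /\ is_sign w0.1.
  by case/and5P: valid => _ _ _ _ /and3P[].
have sign_neq0 c : is_sign c -> c != 0 by case/orP => /eqP ->.
rewrite /G_term; have -> : (n + N).-1 = (n.-1 + N)%N by lia.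
rewrite -addSn; have [c1 e1] := td_term_shift n.+1.
have [c2 e2] := td_term_shift n.-1.
move: c1 e1 c2 e2; move: td_term => g c1 e1 c2 e2.
split=> [|i] /=; last by rewrite e1 e2; have := prednK n0; lia.
by rewrite c1 c2 !mulf_eq0 !expf_eq0 (negPf (sign_neq0 _ w1s)) (negPf (sign_neq0 _ w0s))
  !andbF !orbF.
Qed.

(** w1^(n+1) w1^(n-1) is a square, so a shift by N multiplies G_n by a square. *)
Lemma power_class2_shift n : (0 < n)%N ->
  power_class 2 (n + N) = power_class 2 n.
Proof.
move=> n0; have [E1 E2] := G_term_shift n0; rewrite /power_class E1.
case: ifP => // _; congr Some; apply: eq_map => i.
by rewrite E2 dvdn_addl ?dvdn_mulr.
Qed.

(** Three shifts by N multiply G_n by the sixth power of w1^(n+N) w0. *)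
Lemma power_class3_shift n : (0 < n)%N ->
  power_class 3 (n + 3 * N) = power_class 3 n.
Proof.
move=> n0; have -> : (n + 3 * N = n + N + N + N)%N by lia.
have n1 : (0 < n + N)%N by lia.
have n2 : (0 < n + N + N)%N by lia.
have [E1 E2] := G_term_shift n0; have [E3 E4] := G_term_shift n1.
have [E5 E6] := G_term_shift n2.
rewrite /power_class E5 E3 E1; case: ifP => // _; congr Some; apply: eq_map => i.
have -> : ((G_term (n + N + N + N)).2 i
  = (G_term n).2 i + 3 * (2 * ((n + N) * w1.2 i + w0.2 i)))%N.
  by rewrite E6 E4 E2; ring.
by rewrite dvdn_addl ?dvdn_mulr.
Qed.

Variable a : int.
Let fs := [seq peval a p | p <- td_factors D].
Let v n := mval fs (td_term n).

Lemma td_val_shift n : v (n + N)%N = v n * mval fs w1 ^+ n * mval fs w0.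
Proof.
have [E1 E2] := td_term_shift n; rewrite /v -mval_exp -!mval_mul.
by apply: eq_mval => [|i]; rewrite ?E1 // E2.
Qed.

Lemma td_eds : eds v.
Proof.
case/and5P: valid => N2 /andP[/eqP wN /allP wNe] /allP odd_ok /allP even_ok _.
apply: (eds_of_quasiperiod (ltnW (ltnW N2)) td_val_shift).
- rewrite -!mval_exp /mval /= wN; congr (_ * _); apply: eq_bigr => i _.
  have lt_i : (i < k)%N by case: (i) => j /=; rewrite size_map.
  by rewrite (eqP (wNe i _)) // mem_iota add0n lt_i.
- move=> n Hn; have := odd_ok n; rewrite mem_iota => /(_ Hn).
  by move/(sub_certificateP a); rewrite /v; move: td_term => g; rewrite !mval_mul !mval_exp.
- move=> n Hn; have := even_ok n; rewrite mem_iota => /(_ Hn).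
  by move/(sub_certificateP a); rewrite /v; move: td_term => g; rewrite !mval_mul !mval_exp.
Qed.

Variable W : weierstrass.
Hypotheses (W4 : w_a4 W = 0) (W6 : w_a6 W = 0) (W3 : w_a3 W != 0).
Hypotheses (v0 : v 0 = 0) (v1 : v 1 = 1) (v2 : v 2 = w_a3 W)
  (v3 : v 3 = w_a2 W * w_a3 W ^+ 2)
  (v4 : v 4 = w_a3 W ^+ 4 * (w_a1 W * w_a2 W - w_a3 W)).

Lemma psi_at0_td n : psi_at0 W n = v n.
Proof.
have [p0 p1 p2 p3 p4] := psi_at0_init W4 W6.
apply: eds_unique; [exact: eds_psi_at0|exact: td_eds| |by rewrite v2].
by case=> [|[|[|[|[|n']]]]] // _; congruence.
Qed.

Lemma G_td n : (0 < n)%N -> G W n = mval fs (G_term n).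
Proof.
move=> n0; rewrite G_psi // !psi_at0_td /G_term /v; move: td_term => g.
have E1 : mval fs (-1, fun=> 0%N) = -1.
  by rewrite /mval big1 ?mulr1 // => i _; rewrite expr0.
by rewrite !mval_mul E1 mulN1r.
Qed.

Hypotheses (fs_neq0 : all (fun f => f != 0) fs) (fs_coprime : pairwise coprimez fs).

Lemma power_classP e n : prime e -> (0 < n)%N -> G W n != 0 ->
  exists2 bs, power_class e n = Some bs
    & zpower e (G W n) <-> all_zpower e (mask bs fs).
Proof.
move=> pe n0; rewrite G_td // /power_class.
have sign_term m : (td_term m).1 == 0 \/ is_sign (td_term m).1.
  case/and5P: valid => N2 _ _ _ /and3P[s1 s0 sb] /=.
  have sgX c j : is_sign c -> is_sign (c ^+ j).
    case/orP => /eqP ->; first by rewrite expr1n.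
    by rewrite -signr_odd; case: odd.
  have sgM c d : is_sign c -> is_sign d -> is_sign (c * d).
    by move=> /orP[] /eqP -> /orP[] /eqP ->.
  set b := nth _ _ _; have /orP[/eqP->|sb0] : (b.1 == 0) || is_sign b.1.
  - rewrite /b; have [lt_m|le_m] := ltnP (m %% N) (size (td_base D)).
      exact: (all_nthP _ sb).
    by rewrite nth_default.
  - by rewrite mul0r; left.
  by right; rewrite !sgM ?sgX.
have [c0|c_neq0] := eqVneq (G_term n).1 0; first by rewrite /mval c0 mul0r.
move=> _; eexists; first by [].
have sg : is_sign (G_term n).1.
  move: c_neq0 (sign_term n.+1) (sign_term n.-1); rewrite /G_term.
  move: (td_term n.+1) (td_term n.-1) => [c1 g1] [c2 g2] /= c_neq0.
  case=> [/eqP E|]; first by rewrite E mul0r mulr0 eqxx in c_neq0.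
  move=> s1; case=> [/eqP E|]; first by rewrite E !mulr0 eqxx in c_neq0.
  by case/orP: s1 => /eqP -> /orP[] /eqP ->.
rewrite /mval; have -> x : zpower e ((G_term n).1 * x) <-> zpower e x.
  case/orP: sg => /eqP ->; rewrite ?mul1r ?mulN1r //.
  exact: zpowerN.
by rewrite zpower_prod // size_map.
Qed.
End Torsion.

Lemma td_term_small D fs n : (n < td_order D)%N ->
  mval fs (td_term D n) = mval fs (nth zero_mono (td_base D) n).
Proof.
move=> ltn; rewrite /td_term divn_small // modn_small // mul0n muln0 !mval_mul !mval_exp.
by rewrite !expr0 !mulr1.
Qed.

Lemma mval0 fs (m : mono) : m.1 = 0 -> mval fs m = 0.
Proof. by rewrite /mval => ->; rewrite mul0r. Qed.

(** The residue of n in 1, ..., M. Multiples of M are represented by M and not by 0,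
because the formula for G_n in terms of psi fails at n = 0. *)
Definition representative (M n : nat) : nat := if (n %% M == 0)%N then M else (n %% M)%N.

Lemma G0 W : G W 0 = 1.
Proof. by rewrite /G /phi /eval_xy -polyC1 hornerC -polyC1 hornerC. Qed.

Section Table.
Variables (D : torsion_data) (W : weierstrass) (a : int).
Let fs := [seq peval a p | p <- td_factors D].
Let v n := mval fs (td_term D n).
Hypotheses (valid : td_valid D) (W4 : w_a4 W = 0) (W6 : w_a6 W = 0).
Hypotheses (v0 : v 0 = 0) (v1 : v 1 = 1) (v2 : v 2 = w_a3 W)
  (v3 : v 3 = w_a2 W * w_a3 W ^+ 2)
  (v4 : v 4 = w_a3 W ^+ 4 * (w_a1 W * w_a2 W - w_a3 W)).
Hypotheses (fs_neq0 : all (fun f => f != 0) fs) (fs_coprime : pairwise coprimez fs).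

Lemma mval_neq0 (m : mono) : m.1 != 0 -> mval fs m != 0.
Proof.
move=> m0; rewrite mulf_neq0 //; apply/prodf_neq0 => i _.
by rewrite expf_neq0 // (allP fs_neq0) // mem_nth.
Qed.

Hypothesis c2 : (td_term D 2).1 != 0.

(** The hypothesis on M says that G_M is an e-th power without condition on the
factors; this agrees with G_0 = 1. *)
Lemma power_tableP e M n : prime e -> (0 < M)%N ->
  (forall m, (0 < m)%N -> power_class D e (m + M) = power_class D e m) ->
  power_class D e M = Some (nseq (size fs) false) -> G W n != 0 ->
  exists2 bs, power_class D e (representative M n) = Some bs
    & zpower e (G W n) <-> all_zpower e (mask bs fs).
Proof.
move=> pe M0 shift EM; have W3 : w_a3 W != 0 by rewrite -v2 mval_neq0.
case: (posnP n) => [->|n0] Gn0.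
  rewrite /representative mod0n eqxx EM; eexists; first by [].
  by rewrite mask_false G0; split=> // _; exact: zpower1.
rewrite /representative -power_class_residue //.
exact: (power_classP valid W4 W6 W3 v0 v1 v2 v3 v4).
Qed.

Lemma square_tableP n :
  power_class D 2 (td_order D) = Some (nseq (size fs) false) -> G W n != 0 ->
  exists2 bs, power_class D 2 (representative (td_order D) n) = Some bs
    & zpower 2 (G W n) <-> all_zpower 2 (mask bs fs).
Proof.
move=> EM; apply: power_tableP => //; first by case/andP: valid => /ltnW/ltnW.
exact: power_class2_shift.
Qed.

Lemma cube_tableP n :
  power_class D 3 (3 * td_order D) = Some (nseq (size fs) false) -> G W n != 0 ->
  exists2 bs, power_class D 3 (representative (3 * td_order D) n) = Some bs
    & zpower 3 (G W n) <-> all_zpower 3 (mask bs fs).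
Proof.
move=> EM; apply: power_tableP => //.
  by rewrite muln_gt0; case/andP: valid => /ltnW/ltnW.
exact: power_class3_shift.
Qed.
End Table.

(** Whether G_n is a square or a cube can be read off from the residue of n. *)
Definition power_tables (W : weierstrass) (D : torsion_data) (fs : seq int) : Prop :=
  forall n, G W n != 0 ->
  (exists2 bs, power_class D 2 (representative (td_order D) n) = Some bs
    & zpower 2 (G W n) <-> all_zpower 2 (mask bs fs)) /\
  (exists2 bs, power_class D 3 (representative (3 * td_order D) n) = Some bs
    & zpower 3 (G W n) <-> all_zpower 3 (mask bs fs)).

(** The hypotheses separate what is decided by computation on the data of the curve
from the few facts about the integer a: the factors are nonzero and pairwise
coprime, and the first five terms are right. *)
Lemma tables_intro D W (a : int) (fs : seq int) :
  td_valid D -> (td_term D 2).1 != 0 ->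
  power_class D 2 (td_order D) = Some (nseq (size (td_factors D)) false) ->
  power_class D 3 (3 * td_order D) = Some (nseq (size (td_factors D)) false) ->
  w_a4 W = 0 -> w_a6 W = 0 ->
  fs = [seq peval a p | p <- td_factors D] ->
  all (fun f => f != 0) fs -> pairwise coprimez fs ->
  mval fs (td_term D 0) = 0 -> mval fs (td_term D 1) = 1 ->
  mval fs (td_term D 2) = w_a3 W ->
  mval fs (td_term D 3) = w_a2 W * w_a3 W ^+ 2 ->
  mval fs (td_term D 4) = w_a3 W ^+ 4 * (w_a1 W * w_a2 W - w_a3 W) ->
  power_tables W D fs.
Proof.
move=> valid c2 M2 M3 W4 W6 -> nz cp v0 v1 v2 v3 v4 n Gn0.
by split; [apply: square_tableP|apply: cube_tableP]; rewrite ?size_map.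
Qed.

Ltac expand_mval := rewrite /mval ?big_ord_recl ?big_ord0 /=.

(** * The seven curves *)

(** In all these data the exponents of w1 and w0 are read off from
psi_(N+1) = w1 w0 and psi_(N+2) = psi_2 w1^2 w0. The lists [:: c_0; c_1; ...] are
the factors, and each row of exponents refers to them in this order. *)
Definition torsion_E4 : torsion_data := TorsionData
  [:: [:: 0; 1]] 4
  [:: zero_mono;
     mono_of 1 [:: 0];
     mono_of (-1) [:: 1];
     mono_of (-1) [:: 3]]
  (mono_of (-1) [:: 3])
  (mono_of (-1) [:: 6]).
Definition torsion_E5 : torsion_data := TorsionData
  [:: [:: 0; 1]] 5
  [:: zero_mono;
     mono_of 1 [:: 0];
     mono_of (-1) [:: 1];
     mono_of (-1) [:: 3];
     mono_of 1 [:: 6]]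
  (mono_of 1 [:: 4])
  (mono_of (-1) [:: 10]).
Definition torsion_E6 : torsion_data := TorsionData
  [:: [:: 0; 1]; [:: 1; 1]] 6
  [:: zero_mono;
     mono_of 1 [:: 0; 0];
     mono_of (-1) [:: 1; 1];
     mono_of (-1) [:: 3; 3];
     mono_of 1 [:: 6; 5];
     mono_of 1 [:: 10; 8]]
  (mono_of (-1) [:: 5; 4])
  (mono_of 1 [:: 15; 12]).
Definition torsion_E7 : torsion_data := TorsionData
  [:: [:: 0; 1]; [:: -1; 1]] 7
  [:: zero_mono;
     mono_of 1 [:: 0; 0];
     mono_of (-1) [:: 2; 1];
     mono_of (-1) [:: 6; 3];
     mono_of 1 [:: 11; 6];
     mono_of 1 [:: 17; 10];
     mono_of (-1) [:: 25; 15]]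
  (mono_of 1 [:: 10; 6])
  (mono_of 1 [:: 35; 21]).
Definition torsion_E9 : torsion_data := TorsionData
  [:: [:: 0; 1]; [:: -1; 1]; [:: 1; -1; 1]] 9
  [:: zero_mono;
     mono_of 1 [:: 0; 0; 0];
     mono_of (-1) [:: 2; 1; 1];
     mono_of (-1) [:: 6; 3; 3];
     mono_of 1 [:: 12; 6; 5];
     mono_of 1 [:: 19; 10; 8];
     mono_of (-1) [:: 27; 15; 12];
     mono_of (-1) [:: 37; 21; 16];
     mono_of 1 [:: 49; 28; 21]]
  (mono_of 1 [:: 14; 8; 6])
  (mono_of (-1) [:: 63; 36; 27]).
Definition torsion_E10 : torsion_data := TorsionData
  [:: [:: 0; 1]; [:: -1; 1]; [:: -1; 2]; [:: 1; -3; 1]] 10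
  [:: zero_mono;
     mono_of 1 [:: 0; 0; 0; 0];
     mono_of (-1) [:: 3; 1; 1; 4];
     mono_of (-1) [:: 9; 3; 3; 10];
     mono_of (-1) [:: 16; 6; 6; 19];
     mono_of 1 [:: 25; 10; 10; 30];
     mono_of (-1) [:: 37; 15; 14; 44];
     mono_of (-1) [:: 51; 21; 19; 60];
     mono_of (-1) [:: 66; 28; 25; 79];
     mono_of 1 [:: 84; 36; 32; 100]]
  (mono_of 1 [:: 21; 9; 8; 25])
  (mono_of (-1) [:: 105; 45; 40; 125]).
Definition torsion_E12 : torsion_data := TorsionData
  [:: [:: 0; 1]; [:: -1; 1]; [:: -1; 2]; [:: 1; -3; 3]; [:: 1; -2; 2]] 12
  [:: zero_mono;
     mono_of 1 [:: 0; 0; 0; 0; 0];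
     mono_of (-1) [:: 1; 8; 1; 1; 1];
     mono_of (-1) [:: 3; 20; 3; 3; 3];
     mono_of (-1) [:: 6; 37; 6; 6; 5];
     mono_of 1 [:: 10; 60; 10; 9; 8];
     mono_of (-1) [:: 15; 86; 15; 13; 12];
     mono_of (-1) [:: 21; 119; 20; 18; 16];
     mono_of (-1) [:: 28; 155; 26; 24; 21];
     mono_of 1 [:: 36; 197; 33; 30; 27];
     mono_of (-1) [:: 45; 244; 41; 37; 33];
     mono_of (-1) [:: 55; 295; 50; 45; 40]]
  (mono_of (-1) [:: 11; 59; 10; 9; 8])
  (mono_of (-1) [:: 66; 354; 60; 54; 48]).

Lemma power_tables_E4 (a : int) : a != 0 ->
  power_tables (E4 a) torsion_E4 [:: a].
Proof.
move=> a0; apply: (@tables_intro _ _ a).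
- by vm_compute.
- by vm_compute.
- by vm_compute.
- by vm_compute.
- by [].
- by [].
- by rewrite /= mulr0 addr0 mulr1 add0r.
- by rewrite /= a0.
- by [].
- by apply: mval0; vm_compute.
- by rewrite (td_term_small _ (isT : (1 < td_order torsion_E4)%N)); expand_mval; ring.
- by rewrite (td_term_small _ (isT : (2 < td_order torsion_E4)%N)); expand_mval; ring.
- by rewrite (td_term_small _ (isT : (3 < td_order torsion_E4)%N)); expand_mval; ring.
- by rewrite mval0 ?[RHS]/=; [ring|vm_compute].
Qed.

Lemma power_tables_E5 (a : int) : a != 0 ->
  power_tables (E5 a) torsion_E5 [:: a].
Proof.
move=> a0; apply: (@tables_intro _ _ a).
- by vm_compute.
- by vm_compute.
- by vm_compute.
- by vm_compute.
- by [].
- by [].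
- by rewrite /= mulr0 addr0 mulr1 add0r.
- by rewrite /= a0.
- by [].
- by apply: mval0; vm_compute.
- by rewrite (td_term_small _ (isT : (1 < td_order torsion_E5)%N)); expand_mval; ring.
- by rewrite (td_term_small _ (isT : (2 < td_order torsion_E5)%N)); expand_mval; ring.
- by rewrite (td_term_small _ (isT : (3 < td_order torsion_E5)%N)); expand_mval; ring.
- by rewrite (td_term_small _ (isT : (4 < td_order torsion_E5)%N)); expand_mval; ring.
Qed.

Lemma power_tables_E6 (a : int) : a != -1 -> a != 0 ->
  power_tables (E6 a) torsion_E6 [:: a; a + 1].
Proof.
move=> a1 a0; apply: (@tables_intro _ _ a).
- by vm_compute.
- by vm_compute.
- by vm_compute.
- by vm_compute.
- by [].
- by [].
- by rewrite /=; congr [:: _; _]; ring.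
- by rewrite /= a0 /=; repeat (apply/andP; split=> //); apply/eqP; lia.
- rewrite /= ?andbT; repeat (apply/andP; split).
  + by apply: (@coprimez_bezout _ _ (-1) (1)); ring.
- by apply: mval0; vm_compute.
- by rewrite (td_term_small _ (isT : (1 < td_order torsion_E6)%N)); expand_mval; ring.
- by rewrite (td_term_small _ (isT : (2 < td_order torsion_E6)%N)); expand_mval; ring.
- by rewrite (td_term_small _ (isT : (3 < td_order torsion_E6)%N)); expand_mval; ring.
- by rewrite (td_term_small _ (isT : (4 < td_order torsion_E6)%N)); expand_mval; ring.
Qed.

Lemma power_tables_E7 (a : int) : a != 0 -> a != 1 ->
  power_tables (E7 a) torsion_E7 [:: a; a - 1].
Proof.
move=> a0 a1; apply: (@tables_intro _ _ a).
- by vm_compute.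
- by vm_compute.
- by vm_compute.
- by vm_compute.
- by [].
- by [].
- by rewrite /=; congr [:: _; _]; ring.
- by rewrite /= a0 /=; repeat (apply/andP; split=> //); apply/eqP; lia.
- rewrite /= ?andbT; repeat (apply/andP; split).
  + by apply: (@coprimez_bezout _ _ (1) (-1)); ring.
- by apply: mval0; vm_compute.
- by rewrite (td_term_small _ (isT : (1 < td_order torsion_E7)%N)); expand_mval; ring.
- by rewrite (td_term_small _ (isT : (2 < td_order torsion_E7)%N)); expand_mval; ring.
- by rewrite (td_term_small _ (isT : (3 < td_order torsion_E7)%N)); expand_mval; ring.
- by rewrite (td_term_small _ (isT : (4 < td_order torsion_E7)%N)); expand_mval; ring.
Qed.

Lemma power_tables_E9 (a : int) : a != 0 -> a != 1 ->
  power_tables (E9 a) torsion_E9 [:: a; a - 1; a ^+ 2 - a + 1].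
Proof.
move=> a0 a1; apply: (@tables_intro _ _ a).
- by vm_compute.
- by vm_compute.
- by vm_compute.
- by vm_compute.
- by [].
- by [].
- by rewrite /=; congr [:: _; _; _]; ring.
- have [w Ew] := even_mul_pred a.
  by rewrite /= a0 /=; repeat (apply/andP; split=> //); apply/eqP; lia.
- rewrite /= ?andbT; repeat (apply/andP; split).
  + by apply: (@coprimez_bezout _ _ (1) (-1)); ring.
  + by apply: (@coprimez_bezout _ _ (1 - a) (1)); ring.
  + by apply: (@coprimez_bezout _ _ (- a) (1)); ring.
- by apply: mval0; vm_compute.
- by rewrite (td_term_small _ (isT : (1 < td_order torsion_E9)%N)); expand_mval; ring.
- by rewrite (td_term_small _ (isT : (2 < td_order torsion_E9)%N)); expand_mval; ring.
- by rewrite (td_term_small _ (isT : (3 < td_order torsion_E9)%N)); expand_mval; ring.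
- by rewrite (td_term_small _ (isT : (4 < td_order torsion_E9)%N)); expand_mval; ring.
Qed.

Lemma power_tables_E10 (a : int) : a != 0 -> a != 1 ->
  power_tables (E10 a) torsion_E10 [:: a; a - 1; 2 * a - 1; a ^+ 2 - 3 * a + 1].
Proof.
move=> a0 a1; apply: (@tables_intro _ _ a).
- by vm_compute.
- by vm_compute.
- by vm_compute.
- by vm_compute.
- by [].
- by [].
- by rewrite /=; congr [:: _; _; _; _]; ring.
- have [w Ew] := even_mul_pred a.
  by rewrite /= a0 /=; repeat (apply/andP; split=> //); apply/eqP; lia.
- rewrite /= ?andbT; repeat (apply/andP; split).
  + by apply: (@coprimez_bezout _ _ (1) (-1)); ring.
  + by apply: (@coprimez_bezout _ _ (2) (-1)); ring.
  + by apply: (@coprimez_bezout _ _ (3 - a) (1)); ring.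
  + by apply: (@coprimez_bezout _ _ (-2) (1)); ring.
  + by apply: (@coprimez_bezout _ _ (a - 2) (-1)); ring.
  + by apply: (@coprimez_bezout _ _ (2 * a - 5) (-4)); ring.
- by apply: mval0; vm_compute.
- by rewrite (td_term_small _ (isT : (1 < td_order torsion_E10)%N)); expand_mval; ring.
- by rewrite (td_term_small _ (isT : (2 < td_order torsion_E10)%N)); expand_mval; ring.
- by rewrite (td_term_small _ (isT : (3 < td_order torsion_E10)%N)); expand_mval; ring.
- by rewrite (td_term_small _ (isT : (4 < td_order torsion_E10)%N)); expand_mval; ring.
Qed.

Lemma power_tables_E12 (a : int) : a != 0 -> a != 1 ->
  power_tables (E12 a) torsion_E12
    [:: a; a - 1; 2 * a - 1; 3 * a ^+ 2 - 3 * a + 1; 2 * a ^+ 2 - 2 * a + 1].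
Proof.
move=> a0 a1; apply: (@tables_intro _ _ a).
- by vm_compute.
- by vm_compute.
- by vm_compute.
- by vm_compute.
- by [].
- by [].
- by rewrite /=; congr [:: _; _; _; _; _]; ring.
- have [w Ew] := even_mul_pred a.
  by rewrite /= a0 /=; repeat (apply/andP; split=> //); apply/eqP; lia.
- rewrite /= ?andbT; repeat (apply/andP; split).
  + by apply: (@coprimez_bezout _ _ (1) (-1)); ring.
  + by apply: (@coprimez_bezout _ _ (2) (-1)); ring.
  + by apply: (@coprimez_bezout _ _ (3 - 3 * a) (1)); ring.
  + by apply: (@coprimez_bezout _ _ (2 - 2 * a) (1)); ring.
  + by apply: (@coprimez_bezout _ _ (-2) (1)); ring.
  + by apply: (@coprimez_bezout _ _ (- 3 * a) (1)); ring.
  + by apply: (@coprimez_bezout _ _ (- 2 * a) (1)); ring.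
  + by apply: (@coprimez_bezout _ _ (3 - 6 * a) (4)); ring.
  + by apply: (@coprimez_bezout _ _ (1 - 2 * a) (2)); ring.
  + by apply: (@coprimez_bezout _ _ (-2) (3)); ring.
- by apply: mval0; vm_compute.
- by rewrite (td_term_small _ (isT : (1 < td_order torsion_E12)%N)); expand_mval; ring.
- by rewrite (td_term_small _ (isT : (2 < td_order torsion_E12)%N)); expand_mval; ring.
- by rewrite (td_term_small _ (isT : (3 < td_order torsion_E12)%N)); expand_mval; ring.
- by rewrite (td_term_small _ (isT : (4 < td_order torsion_E12)%N)); expand_mval; ring.
Qed.

(** * Squares and cubes among the numerators *)

(** For a concrete residue the table turns into a propositional statement about
which factors are squares or cubes. The Diophantine facts in the context exclude
the impossible combinations. *)
Ltac residue_case E K :=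
  vm_compute in E;
  solve [ discriminate E
        | injection E as <-; rewrite /all_zpower /= in K;
          rewrite ?inE /= ?is_squareE ?is_cubeE; tauto ].

Ltac residue_cases r lt_r E K :=
  first [ solve [by move: lt_r]
        | destruct r as [|r]; [ residue_case E K | residue_cases r lt_r E K ] ].

Ltac by_residue n M E K :=
  let lt_r := fresh "lt_r" in let r := fresh "r" in
  assert (lt_r : (n %% M < M)%N) by (rewrite ltn_pmod; done);
  move: (n %% M)%N lt_r E => r lt_r E;
  residue_cases r lt_r E K.

Theorem theoremB1 :
  (forall (a : int) (n : nat), a != 0 -> G (E4 a) n != 0 ->
     (if (n %% 4 == 0)%N then is_square (G (E4 a) n)
      else (is_square (G (E4 a) n) <-> is_square a))
     /\ is_cube (G (E4 a) n))
  /\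
  (forall (a : int) (n : nat), a != 0 -> G (E5 a) n != 0 ->
     (if (n %% 5 == 0)%N then is_square (G (E5 a) n)
      else (is_square (G (E5 a) n) <-> is_square a))
     /\
     (if (n %% 15 \in [:: 0; 2; 7; 8; 13])%N then is_cube (G (E5 a) n)
      else (is_cube (G (E5 a) n) <-> is_cube a)))
  /\
  (forall (a : int) (n : nat), a != -1 -> a != 0 -> G (E6 a) n != 0 ->
     (if (n %% 6 == 0)%N then is_square (G (E6 a) n)
      else if (n %% 6 == 3)%N then (is_square (G (E6 a) n) <-> is_square a)
      else ~ is_square (G (E6 a) n))
     /\
     (if (n %% 18 \in [:: 0; 2; 6; 12; 16])%N then is_cube (G (E6 a) n)
      else if (n %% 18 \in [:: 3; 9; 15])%N
        then (is_cube (G (E6 a) n) <-> is_cube a)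
      else ~ is_cube (G (E6 a) n)))
  /\
  (forall (a : int) (n : nat), a != 0 -> a != 1 -> G (E7 a) n != 0 ->
     (if (n %% 7 == 0)%N then is_square (G (E7 a) n)
      else if (n %% 7 \in [:: 2; 5])%N
        then (is_square (G (E7 a) n) <-> is_square (a - 1))
      else ~ is_square (G (E7 a) n))
     /\
     (if (n %% 21 \in [:: 0; 2; 5; 16; 19])%N then is_cube (G (E7 a) n)
      else if (n %% 21 \in [:: 7; 9; 12; 14])%N
        then (is_cube (G (E7 a) n) <-> is_cube a)
      else ~ is_cube (G (E7 a) n)))
  /\
  (forall (a : int) (n : nat), a != 0 -> a != 1 -> G (E9 a) n != 0 ->
     (if (n %% 9 == 0)%N then is_square (G (E9 a) n)
      else if (n %% 9 \in [:: 3; 6])%N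
        then (is_square (G (E9 a) n) <-> is_square (a - 1))
      else ~ is_square (G (E9 a) n))
     /\
     (if (n %% 27 \in [:: 0; 2; 9; 18; 25])%N then is_cube (G (E9 a) n)
      else if (n %% 27 \in [:: 5; 22])%N
        then (is_cube (G (E9 a) n) <-> is_cube (a ^+ 2 - a + 1))
      else ~ is_cube (G (E9 a) n)))
  /\
  (forall (a : int) (n : nat), a != 0 -> a != 1 -> G (E10 a) n != 0 ->
     (if (n %% 10 == 0)%N then is_square (G (E10 a) n)
      else if (n %% 10 \in [:: 4; 6])%N
        then (is_square (G (E10 a) n) <-> is_square ((a - 1) * (2 * a - 1)))
      else ~ is_square (G (E10 a) n))
     /\
     (if (n %% 30 == 0)%N then is_cube (G (E10 a) n)
      else if (n %% 30 \in [:: 2; 8; 22; 28])%N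
        then (is_cube (G (E10 a) n) <-> is_cube (a ^+ 2 - 3 * a + 1))
      else if (n %% 30 \in [:: 12; 18])%N
        then (is_cube (G (E10 a) n) <-> is_cube (2 * a - 1))
      else ~ is_cube (G (E10 a) n)))
  /\
  (forall (a : int) (n : nat), a != 0 -> a != 1 -> G (E12 a) n != 0 ->
     (if (n %% 12 == 0)%N then is_square (G (E12 a) n)
      else ~ is_square (G (E12 a) n))
     /\
     (if (n %% 36 \in [:: 0; 12; 24])%N then is_cube (G (E12 a) n)
      else if (n %% 36 \in [:: 16; 20])%N
        then (is_cube (G (E12 a) n) <-> is_cube a)
      else if (n %% 36 \in [:: 2; 34])%N
        then (is_cube (G (E12 a) n) <-> is_cube (a - 1))
      else ~ is_cube (G (E12 a) n))).
Proof.
split; [|split; [|split; [|split; [|split; [|split]]]]].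
- move=> a n a0 g0; have [[b2 E2 K2] [b3 E3 K3]] := power_tables_E4 a0 g0.
  move: (G _ n) g0 K2 K3 => g g0 K2 K3; rewrite /representative /= in E2 E3.
  by split; [by_residue n 4%N E2 K2 | by_residue n 12%N E3 K3].
- move=> a n a0 g0; have [[b2 E2 K2] [b3 E3 K3]] := power_tables_E5 a0 g0.
  move: (G _ n) g0 K2 K3 => g g0 K2 K3; rewrite /representative /= in E2 E3.
  by split; [by_residue n 5%N E2 K2 | by_residue n 15%N E3 K3].
- move=> a n a1 a0 g0; have [[b2 E2 K2] [b3 E3 K3]] := power_tables_E6 a1 a0 g0.
  have consec e : (1 < e)%N -> zpower e (a + 1) -> zpower e a -> False.
    by move=> e1 za1 za; apply: (consecutive_powers e1 za1); rewrite addrK.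
  have c2 := consec 2%N isT; have c3 := consec 3%N isT.
  move: (G _ n) g0 K2 K3 => g g0 K2 K3; rewrite /representative /= in E2 E3.
  by split; [by_residue n 6%N E2 K2 | by_residue n 18%N E3 K3].
- move=> a n a0 a1 g0; have [[b2 E2 K2] [b3 E3 K3]] := power_tables_E7 a0 a1 g0.
  have c2 := @consecutive_powers 2 a isT; have c3 := @consecutive_powers 3 a isT.
  move: (G _ n) g0 K2 K3 => g g0 K2 K3; rewrite /representative /= in E2 E3.
  by split; [by_residue n 7%N E2 K2 | by_residue n 21%N E3 K3].
- move=> a n a0 a1 g0; have [[b2 E2 K2] [b3 E3 K3]] := power_tables_E9 a0 a1 g0.
  have c2 := @consecutive_powers 2 a isT; have c3 := @consecutive_powers 3 a isT.
  have q2 := quadratic_not_square a0 a1.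
  move: (G _ n) g0 K2 K3 => g g0 K2 K3; rewrite /representative /= in E2 E3.
  by split; [by_residue n 9%N E2 K2 | by_residue n 27%N E3 K3].
- move=> a n a0 a1 g0; have [[b2 E2 K2] [b3 E3 K3]] := power_tables_E10 a0 a1 g0.
  have c2 := @consecutive_powers 2 a isT; have c3 := @consecutive_powers 3 a isT.
  have d3 := no_cubes_a_2a1 a0 a1; have e3 := no_cubes_2a1_golden a0 a1.
  have f3 := no_two_cubes_quadratic a0 a1.
  have p2 : zpower 2 ((a - 1) * (2 * a - 1)) <-> zpower 2 (a - 1) /\ zpower 2 (2 * a - 1).
    apply: zpower_mul => //; last by apply/eqP; lia.
      by apply: (@coprimez_bezout _ _ (-2) 1); ring.
    by rewrite subr_eq0.
  move: (G _ n) g0 K2 K3 => g g0 K2 K3; rewrite /representative /= in E2 E3.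
  by split; [by_residue n 10%N E2 K2 | by_residue n 30%N E3 K3].
- move=> a n a0 a1 g0; have [[b2 E2 K2] [b3 E3 K3]] := power_tables_E12 a0 a1 g0.
  have c2 := @consecutive_powers 2 a isT; have c3 := @consecutive_powers 3 a isT.
  have d3 := no_cubes_a_2a1 a0 a1; have e3 := no_cubes_a1_2a1 a0 a1.
  have f3 := sum_consecutive_squares_not_cube a0 a1; have q2 := no_squares_2a1_sum a0 a1.
  move: (G _ n) g0 K2 K3 => g g0 K2 K3; rewrite /representative /= in E2 E3.
  by split; [by_residue n 12%N E2 K2 | by_residue n 36%N E3 K3].
Qed.
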